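(* The two algorithms AutOrder and AffCycle described in the context, viewed as deterministic algorithms, are correct, i.e., they terminate on each input of the indicated form with the asserted output. Explicitly: (1) For every finite solvable group $G$ given through a refined consistent polycyclic presentation $\langle X\mid R\rangle$, and every automorphism $\alpha$ of $G$ given through its $X$-exponent matrix, AutOrder terminates and returns the order of $\alpha$ in $\operatorname{Aut}(G)$. (2) For every finite solvable group $G$ given through a refined consistent polycyclic presentation $\langle X\mid R\rangle$, all $g,t\in G$ given through their $X$-exponent vectors, and every automorphism $\alpha$ of $G$ given through its $X$-exponent matrix, AffCycle terminates and returns the cycle length of $g$ under the bijective affine map $A_{t,\alpha}:G\to G$, $x\mapsto t\alpha(x)$, i.e., the least $n\in\mathbb{N}^+$ with $A_{t,\alpha}^n(g)=g$.
   Context: **Pcgs and presentations.** A pcgs of a finite solvable group $G$ is a tuple $\vec g=(g_1,\ldots,g_n)$ of elements such that, with $C_i:=\langle g_i,\ldots,g_n\rangle$ and $C_{n+1}=\{1\}$, we have $C_1=G$, $C_{i+1}\unlhd C_i$, and $p_i:=|C_i/C_{i+1}|$ is prime for all $i$; $p_i$ is the relative order of $g_i$. Every $h\in G$ is uniquely $h=g_1^{e_1}\cdots g_n^{e_n}$ with $0\le e_i<p_i$; write $\exp_{\vec g}(h,i):=e_i$, and call $(e_1,\ldots,e_n)$ the $\vec g$-exponent vector of $h$. The $\vec g$-exponent matrix of $\alpha\in\operatorname{Aut}(G)$ is the $n$-tuple of $\vec g$-exponent vectors of $\alpha(g_1),\ldots,\alpha(g_n)$. A refined consistent polycyclic presentation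 of $G$ is the presentation associated with a pcgs (power relations and conjugation relations, right-hand sides in collected form); its generating tuple $X$ is identified with a pcgs of $G$. **LG-series.** For a finite group $H$ let $H^\infty$ be the last term of its lower central series. The lower nilpotent series of $G$ is $N_1=G$, $N_{i+1}=N_i^\infty$. For a finite nilpotent group $H$, the lower elementary central series is $\lambda_1(H)=H$ and $\lambda_{j+1}(H)$ the smallest normal subgroup of $H$ contained in $\lambda_j(H)$ such that $\lambda_j(H)/\lambda_{j+1}(H)$ is central in $H/\lambda_{j+1}(H)$ and is a direct product of elementary abelian groups. Let $N_{i,j}$ be the preimage in $N_i$ of $\lambda_j(N_i/N_{i+1})$. Refine each step $N_{i,j}>N_{i,j+1}$: if $q_1<\cdots<q_s$ are the primes dividing $|N_{i,j}/N_{i,j+1}|$, insert $N_{i,j}=H_0>H_1>\cdots>H_s=N_{i,j+1}$ where $H_k/N_{i,j+1}$ is the group of $q_k$-th powers in $H_{k-1}/N_{i,j+1}$. The resulting characteristic series $G=G_1>G_2>\cdots>G_r>G_{r+1}=\{1\}$, with elementary abelian factors, is the LG-series of $G$. A pcgs $\vec g$ refines it if each $G_j$ is one of the subgroups $\langle g_i,\ldots,g_n\rangle$ or trivial. The final weight of $g\in G\setminus\{1\}$ is the largest $w\in\{1,\ldots,r\}$ with $g\in G_w$. **AutOrder.** Input: $\langle X\mid R\rangle$ and $\alpha$. 1. Compute a pcgs $\vec g=(g_1,\ldots,g_n)$ of $G$ refining the LG-series, its associated presentation, the final weights of the $g_i$, and the $\vec g$-exponent matrix of $\alpha$. 2. For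 $i=1,\ldots,r$, let $\ell_i$ be the number of entries of $\vec g$ of final weight $i$, put $L(i):=\sum_{t=1}^i\ell_t$, and let $p_i$ be the common relative order of the $g_j$ with $L(i-1)<j\le L(i)$. 3. For $i=1,\ldots,r$, let $M_i\in\operatorname{GL}_{\ell_i}(p_i)$ be the matrix over $\mathbb{F}_{p_i}$ whose $(j,k)$-entry is $\exp_{\vec g}(\alpha(g_{L(i-1)+k}),L(i-1)+j)$ modulo $p_i$, and let $o_i$ be the order of $M_i$ (computed with the Celler–Leedham-Green matrix order algorithm, using any deterministic integer factorization algorithm). 4. Set $o:=\operatorname{lcm}(o_1,\ldots,o_r)$ and $\beta:=\alpha^o$ (computed as $\vec g$-exponent matrix). 5. For $i=1,\ldots,r-1$ in turn: if at least one of the numbers $\exp_{\vec g}(\beta(g_j),k)$ with $1\le j\le L(i)$ and $L(i)<k\le L(i+1)$ is nonzero, replace $o$ by $o\cdot p_{i+1}$ and $\beta$ by $\beta^{p_{i+1}}$. 6. Return $o$. **AffCycle.** Input: $\langle X\mid R\rangle$, $g,t,\alpha$. 1. As in step 1 of AutOrder, and also compute the $\vec g$-exponent vectors of $g$ and $t$. 2. As in step 2 of AutOrder. Set $\lambda:=1$. 3. For $i=1,\ldots,r$ in turn (with the current values of $t$ and $\alpha$): let $M_i$ be defined from $\alpha$ as in step 3 of AutOrder; let $u_i\in\mathbb{F}_{p_i}^{\ell_i}$ have $j$-th entry $\exp_{\vec g}(g^{-1}t\alpha(g),L(i-1)+j)$ modulo $p_i$; let $\lambda_i$ be the cycle length of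 the zero vector under $v\mapsto M_iv+u_i$ on $\mathbb{F}_{p_i}^{\ell_i}$, computed by the subroutine below; replace $\lambda$ by $\lambda\lambda_i$; replace $(t,\alpha)$ by the pair $(t',\alpha')$ with $A_{t',\alpha'}=A_{t,\alpha}^{\lambda_i}$. 4. Return $\lambda$. **Subroutine** (cycle length of $0$ under $v\mapsto Mv+u$ on $\mathbb{F}_p^d$, $M$ invertible). (a) Compute $T$ with $T^{-1}MT$ in rational canonical form and replace $(u,M)$ by $(T^{-1}u,T^{-1}MT)$; the result is the lcm of the results for the companion matrix blocks. (b) For $M$ the companion matrix of a monic $P\in\mathbb{F}_p[x]$ of degree $d$, identify $\mathbb{F}_p^d$ with $\mathbb{F}_p[x]/(P)$ via $(a_1,\ldots,a_d)\mapsto\sum_{l=0}^{d-1}a_{l+1}x^l+(P)$, so that $M$ becomes multiplication by $x$, and let $S$ be the polynomial corresponding to $u$. (c) Factor $P=\prod_j Q_j^{m_j}$ into powers of pairwise distinct irreducibles (Berlekamp's deterministic algorithm); the result is the lcm over $j$ of the cycle lengths of $0$ under $F\mapsto xF+S$ on $\mathbb{F}_p[x]/(Q_j^{m_j})$. (d) For $P=Q^m$, $Q$ irreducible: if $S\equiv0\pmod{Q^m}$, the cycle length is $1$; otherwise let $v<m$ be the $Q$-adic valuation of $S$, and the cycle length is the order of the polynomial $Q^{m-v+\delta_{Q,x-1}}$, i.e., the least $n\ge1$ such that this polynomial divides $x^n-1$ (computed by the standard formulas for orders of powers of irreducible polynomials, using the factorization of $p^{\deg Q}-1$); here $\delta_{Q,x-1}$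 is $1$ if $Q=x-1$ and $0$ otherwise. *)

(* Defs.v *)
From HB Require Import structures.
From mathcomp Require Import all_boot all_order all_algebra all_fingroup all_solvable.

Set Implicit Arguments.
Unset Strict Implicit.
Unset Printing Implicit Defensive.

Import GroupScope GRing.Theory.

Definition least_pos (Q : nat -> Prop) (n : nat) : Prop :=
  [/\ 0 < n, Q n & forall m, 0 < m -> Q m -> n <= m].

(* Algorithms are terms of [comp].  [Call spec k] calls a subroutine that is
   known only through its output specification [spec] and continues with its
   output.  [returns c a] is total correctness: every called subroutine has an
   admissible output, and whichever admissible outputs are delivered, the
   algorithm halts with result [a].  In particular [a] is the result of every
   deterministic implementation. *)
Inductive comp (A : Type) : Type :=
| Ret of A
| Call (B : Type) (spec : B -> Prop) (k : B -> comp A).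

Fixpoint bind (A B : Type) (c : comp A) (f : A -> comp B) : comp B :=
  match c with
  | Ret a => f a
  | Call _ spec k => Call spec (fun b => bind (k b) f)
  end.

Fixpoint returns (A : Type) (c : comp A) (a : A) : Prop :=
  match c with
  | Ret x => x = a
  | Call _ spec k => (exists b, spec b) /\ (forall b, spec b -> returns (k b) a)
  end.

Fixpoint foldM (I S : Type) (f : S -> I -> comp S) (s : S) (l : seq I) : comp S :=
  if l is x :: l' then bind (f s x) (fun s' => foldM f s' l') else Ret s.

Definition lcmM (I : Type) (f : I -> comp nat) (l : seq I) : comp nat :=
  foldM (fun o x => bind (f x) (fun m => Ret (lcmn o m))) 1%N l.

(* Sequences are indexed from 0: [tail_group g i] is C_(i+1), and likewise for
   all positions in tuples, exponent vectors and matrices below. *)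
Section Pcgs.
Variable gT : finGroupType.
Implicit Types (G : {group gT}) (g : seq gT) (h : gT) (e : seq nat).

Definition tail_group g i : {group gT} := <<[set x in drop i g]>>%G.

Definition relative_order g i : nat := #|tail_group g i / tail_group g i.+1|.

Definition pcgs G g : Prop :=
  tail_group g 0 = G /\
  forall i, i < size g ->
    tail_group g i.+1 <| tail_group g i /\ prime (relative_order g i).

Definition expvec g h e : Prop :=
  [/\ size e = size g,
      forall i, i < size g -> nth 0%N e i < relative_order g i
    & h = \prod_(i < size g) nth 1 g i ^+ nth 0%N e i].

Definition expvecs g (hs : seq gT) (es : seq (seq nat)) : Prop :=
  size es = size hs /\
  forall i, i < size hs -> expvec g (nth 1 hs i) (nth [::] es i).

(* The i-th entry of an exponent matrix is the exponent vector of alpha(g_i). *)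
Definition expmatrix g (alpha : {perm gT}) (A : seq (seq nat)) : Prop :=
  expvecs g [seq alpha x | x <- g] A.

End Pcgs.

(* The relations whose leading generator is g_i: the relative order p_i, the
   exponents of g_i^(p_i), and those of g_j^(g_i) for j = i+1, ..., n.  All
   exponent vectors are relative to the generators after g_i. *)
Record pcrel := PcRel {
  rel_order : nat;
  rel_power : seq nat;
  rel_conj : seq (seq nat) }.

Definition pcrel0 : pcrel := PcRel 0 [::] [::].

Definition presentation_of (gT : finGroupType) (g : seq gT) (R : seq pcrel) : Prop :=
  size R = size g /\
  forall i, i < size g ->
    let Ri := nth pcrel0 R i in
    let gi := nth 1 g i in
    let gs := drop i.+1 g in
    [/\ rel_order Ri = relative_order g i,
        expvec gs (gi ^+ rel_order Ri) (rel_power Ri)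
      & expvecs gs [seq x ^ gi | x <- gs] (rel_conj Ri)].

(* Arithmetic with exponent vectors, computed from the presentation alone. *)
Definition vec_pow (mul : seq nat -> seq nat -> seq nat) (one v : seq nat) (k : nat) :
    seq nat := iter k (mul v) one.

Definition vec_eval (mul : seq nat -> seq nat -> seq nat) (one : seq nat)
    (vs : seq (seq nat)) (e : seq nat) : seq nat :=
  foldr mul one [seq vec_pow mul one ve.1 ve.2 | ve <- zip vs e].

(* (x^a u)(x^b v) = x^(a+b) u^(x^b) v, where x is the first generator *)
Fixpoint pc_mul (R : seq pcrel) (v w : seq nat) : seq nat :=
  match R, v, w with
  | R1 :: R', a :: v', b :: w' =>
      let mul := pc_mul R' in
      let conj := vec_eval mul (nseq (size R') 0%N) (rel_conj R1) in
      let u := mul (iter b conj v') w' in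
      if a + b < rel_order R1 then (a + b)%N :: u
      else (a + b - rel_order R1)%N :: mul (rel_power R1) u
  | _, _, _ => [::]
  end.

Definition pc_one (R : seq pcrel) : seq nat := nseq (size R) 0%N.

Definition pc_inv (R : seq pcrel) (v : seq nat) : seq nat :=
  vec_pow (pc_mul R) (pc_one R) v (\prod_(x <- R) rel_order x).-1.

Definition pc_app (R : seq pcrel) (A : seq (seq nat)) (v : seq nat) : seq nat :=
  vec_eval (pc_mul R) (pc_one R) A v.

(* the exponent matrix of x |-> alpha(beta(x)) *)
Definition pc_comp (R : seq pcrel) (A B : seq (seq nat)) : seq (seq nat) :=
  [seq pc_app R A v | v <- B].

Definition pc_id (R : seq pcrel) : seq (seq nat) :=
  [seq [seq nat_of_bool (i == j) | j <- iota 0 (size R)] | i <- iota 0 (size R)].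

Definition pc_aut_pow (R : seq pcrel) (A : seq (seq nat)) (k : nat) : seq (seq nat) :=
  iter k (pc_comp R A) (pc_id R).

(* The pair (t, A) stands for x |-> t alpha(x), so that
   (t, alpha) o (s, beta) = (t alpha(s), alpha o beta). *)
Definition pc_aff_comp (R : seq pcrel) (x y : seq nat * seq (seq nat)) :
    seq nat * seq (seq nat) :=
  (pc_mul R x.1 (pc_app R x.2 y.1), pc_comp R x.2 y.2).

Definition pc_aff_pow (R : seq pcrel) (x : seq nat * seq (seq nat)) (k : nat) :
    seq nat * seq (seq nat) :=
  iter k (pc_aff_comp R x) (pc_one R, pc_id R).

Section LGSeries.
Variable gT : finGroupType.
Implicit Types (G H K L N : {group gT}) (A : {set gT}).

(* 'L_m(H) is stationary from some m <= #|H| on. *)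
Definition lower_central_limit H : {group gT} := 'L_#|H|(H)%G.

Definition lower_nilpotent G (i : nat) : {group gT} :=
  iter i.-1 lower_central_limit G.

Definition dprod_of_abelems A : bool :=
  [exists F : {set {group gT}},
     [forall E in F, is_abelem E] && (\big[dprod/1]_(E in F) E == A)].

End LGSeries.

(* The groups L over which the intersection is taken are closed under
   intersection, so it is the smallest of them. *)
Definition lower_elementary_next (gT : finGroupType) (H K : {group gT}) : {group gT} :=
  (\bigcap_(L : {group gT} | [&& L <| H, L \subset K, K / L \subset 'Z(H / L)
                               & dprod_of_abelems (K / L)]) L)%G.

Definition lower_elementary (gT : finGroupType) (H : {group gT}) (j : nat) : {group gT} :=
  iter j.-1 (lower_elementary_next H) H.

Section LGSeriesRefined.
Variable gT : finGroupType.
Implicit Types (G H K N : {group gT}).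

Definition LG_term G (i j : nat) : {group gT} :=
  let N := lower_nilpotent G i in
  let N' := lower_nilpotent G i.+1 in
  (N :&: coset N' @*^-1 (lower_elementary (N / N') j))%G.

Definition power_preimage K H (q : nat) : {group gT} :=
  (H :&: coset K @*^-1 <<[set x ^+ q | x in H / K]>>)%G.

(* H_0, ..., H_(s-1); the last term H_s = N_(i,j+1) is left to the next step *)
Definition LG_refined_step G (i j : nat) : seq {group gT} :=
  let H := LG_term G i j in
  let K := LG_term G i j.+1 in
  belast H (scanl (power_preimage K) H (primes #|H / K|)).

(* [:: G_1; ...; G_r].  The ranges of i and j exceed the lengths of the series
   involved; the superfluous steps are trivial and contribute no terms. *)
Definition LG_series G : seq {group gT} :=
  flatten [seq LG_refined_step G i j | i <- iota 1 #|G|, j <- iota 1 #|G|].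

Definition refines_LG G (g : seq gT) : Prop :=
  forall H, H \in LG_series G ->
    H = 1%G \/ exists2 i, i < size g & H = tail_group g i.

Definition final_weight G (h : gT) : nat :=
  \max_(w <- iota 1 (size (LG_series G)) | h \in nth 1%G (LG_series G) w.-1) w.

End LGSeriesRefined.

(* Output of the first step, for a tuple of further elements to be converted:
   the new pcgs and those elements as exponent vectors with respect to the old
   and the new pcgs, respectively. *)
Record LG_data := LGData {
  lg_gens : seq (seq nat);
  lg_pres : seq pcrel;
  lg_length : nat;
  lg_weights : seq nat;
  lg_matrix : seq (seq nat);
  lg_elts : seq (seq nat) }.

(* The group G presented by R is determined up to an isomorphism matching the
   generating tuples, whence the existential quantifier. *)
Definition LG_data_spec (R : seq pcrel) (A es : seq (seq nat)) (D : LG_data) : Prop :=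
  exists (gT : finGroupType) (G : {group gT}) (X g ys : seq gT) (alpha : {perm gT}),
    [/\ pcgs G X /\ presentation_of X R,
        [/\ alpha \in Aut G, expmatrix X alpha A & expvecs X ys es],
        [/\ pcgs G g, refines_LG G g & expvecs X g (lg_gens D)],
        [/\ presentation_of g (lg_pres D),
            lg_length D = size (LG_series G)
          & lg_weights D = [seq final_weight G x | x <- g]]
      & expmatrix g alpha (lg_matrix D) /\ expvecs g ys (lg_elts D)].

Definition layer_size (D : LG_data) (i : nat) : nat := count_mem i (lg_weights D).

Definition layer_end (D : LG_data) (i : nat) : nat :=
  \sum_(1 <= t < i.+1) layer_size D t.

Definition layer_prime (D : LG_data) (i : nat) : nat :=
  rel_order (nth pcrel0 (lg_pres D) (layer_end D i.-1)).

Definition entry (A : seq (seq nat)) (j k : nat) : nat := nth 0%N (nth [::] A j) k.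

Local Open Scope ring_scope.

Definition layer_matrix (D : LG_data) (A : seq (seq nat)) (i : nat) :
    'M['F_(layer_prime D i)]_(layer_size D i) :=
  \matrix_(j, k) (entry A (layer_end D i.-1 + k) (layer_end D i.-1 + j))%:R.

Definition layer_vector (D : LG_data) (v : seq nat) (i : nat) :
    'cV['F_(layer_prime D i)]_(layer_size D i) :=
  \col_j (nth 0%N v (layer_end D i.-1 + j))%:R.

Definition matrix_order (p d : nat) (M : 'M['F_p]_d) : comp nat :=
  Call (least_pos (fun n => M ^+ n = 1)) (@Ret nat).

Definition AutOrder (R : seq pcrel) (A : seq (seq nat)) : comp nat :=
  Call (LG_data_spec R A [::]) (fun D =>
  let R' := lg_pres D in
  let r := lg_length D in
  bind (lcmM (fun i => matrix_order (layer_matrix D (lg_matrix D) i)) (iota 1 r))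
  (fun o =>
  bind (foldM
    (fun (s : nat * seq (seq nat)) i =>
       let p := layer_prime D i.+1 in
       if has (fun j => has (fun k => entry s.2 j k != 0%N)
                 (iota (layer_end D i) (layer_size D i.+1)))
            (iota 0 (layer_end D i))
       then Ret ((s.1 * p)%N, pc_aut_pow R' s.2 p)
       else Ret s)
    (o, pc_aut_pow R' (lg_matrix D) o) (iota 1 r.-1))
  (fun s => Ret s.1))).

(* The library's [companionmx] acts on row vectors; [companion P] is the matrix
   of multiplication by 'X acting on the column vectors of coefficients. *)
Definition companion (F : fieldType) (P : {poly F}) : 'M[F]_((size P).-1) :=
  (companionmx P)^T.

Record rcf_data (F : fieldType) (d : nat) := RcfData {
  rcf_count : nat;
  rcf_poly : 'I_rcf_count -> {poly F};
  rcf_dim : (\sum_i (size (rcf_poly i)).-1)%N = d;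
  rcf_trans : 'M[F]_d }.

Arguments rcf_poly {F d} C i : rename.

Definition rcf_spec (F : fieldType) (d : nat) (M : 'M[F]_d) (C : rcf_data F d) : Prop :=
  [/\ forall i, rcf_poly C i \is monic /\ (1 < size (rcf_poly C i))%N,
      forall i j : 'I_(rcf_count C), (i <= j)%N -> rcf_poly C i %| rcf_poly C j,
      rcf_trans C \in unitmx
    & invmx (rcf_trans C) *m M *m rcf_trans C =
      castmx (rcf_dim C, rcf_dim C) (\mxdiag_i companion (rcf_poly C i))].

Definition rcf_block (F : fieldType) (d : nat) (C : rcf_data F d) (u : 'cV[F]_d)
    (i : 'I_(rcf_count C)) : 'cV[F]_((size (rcf_poly C i)).-1) :=
  submxcol (castmx (esym (rcf_dim C), erefl 1%N) (invmx (rcf_trans C) *m u)) i.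

Definition factorization_spec (F : fieldType) (P : {poly F})
    (fs : seq ({poly F} * nat)) : Prop :=
  [/\ uniq [seq f.1 | f <- fs],
      forall f, f \in fs ->
        [/\ f.1 \is monic, irreducible_poly f.1 & (0 < f.2)%N]
    & P = \prod_(f <- fs) f.1 ^+ f.2].

Definition poly_order (F : fieldType) (P : {poly F}) : comp nat :=
  Call (least_pos (fun n => P %| 'X^n - 1)) (@Ret nat).

Definition zero_cycle_primary (F : fieldType) (S Q : {poly F}) (m : nat) : comp nat :=
  if Q ^+ m %| S then Ret 1%N
  else
    let v := \max_(k < m | Q ^+ k %| S) (k : nat) in
    poly_order (Q ^+ (m - v + (Q == 'X - 1))).

Definition zero_cycle_companion (F : fieldType) (P S : {poly F}) : comp nat :=
  Call (factorization_spec P) (fun fs =>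
  lcmM (fun f => zero_cycle_primary S f.1 f.2) fs).

Definition zero_cycle (F : fieldType) (d : nat) (M : 'M[F]_d) (u : 'cV[F]_d) : comp nat :=
  Call (rcf_spec M) (fun C =>
  lcmM (fun i => zero_cycle_companion (rcf_poly C i) (rVpoly (rcf_block u i)^T))
       (enum 'I_(rcf_count C))).

Definition AffCycle (R : seq pcrel) (g t : seq nat) (A : seq (seq nat)) : comp nat :=
  Call (LG_data_spec R A [:: g; t]) (fun D =>
  let R' := lg_pres D in
  let g' := nth [::] (lg_elts D) 0 in
  let t' := nth [::] (lg_elts D) 1 in
  bind (foldM
    (fun (s : nat * (seq nat * seq (seq nat))) i =>
       let: (lam, (t1, A1)) := s in
       let w := pc_mul R' (pc_inv R' g') (pc_mul R' t1 (pc_app R' A1 g')) in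
       bind (zero_cycle (layer_matrix D A1 i) (layer_vector D w i))
       (fun lam_i => Ret ((lam * lam_i)%N, pc_aff_pow R' (t1, A1) lam_i)))
    (1%N, (t', lg_matrix D)) (iota 1 (lg_length D)))
  (fun s => Ret s.1)).

Local Close Scope ring_scope.

Definition affine_map (gT : finGroupType) (t : gT) (alpha : {perm gT}) (x : gT) : gT :=
  t * alpha x.

Definition is_cycle_length (T : Type) (f : T -> T) (x : T) (n : nat) : Prop :=
  least_pos (fun m => iter m f x = x) n.

(* Main.v *)
Require Import Defs.
From mathcomp Require Import all_boot all_order all_algebra all_fingroup all_solvable.
From Stdlib Require Import Classical.

(** Both algorithms compute a number a for which some property Q(n) holds
    exactly when a divides n ([period Q a]): Q(n) is alpha^n = 1 in the first
    case and A^n(g) = g in the second.  Such an a is unique, so it is enough to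
    show that every run delivers some a with [period Q a], whatever the called
    subroutines return ([returns_some_call]); and the property is stable under
    lcm and under refining Q step by step along a series of subgroups.

    The data computed in the first step live in some group presented by R,
    possibly different from the given one.  As multiplication, alpha and the
    affine map can be carried out on exponent vectors from R and A alone
    ([pc_mulP], [pc_appP]), alpha^n = 1 and A^n(g) = g are statements about R
    and A ([aut_pow_eq1], [affine_cycle_eq]) and do not depend on that group.

    The LG-series G = G_1 > ... > G_(r+1) = 1 is strictly decreasing, consists
    of characteristic subgroups and has elementary abelian factors
    ([LG_seriesP]).  The main point is an explicit description of the lower
    elementary central series ([lower_elementary_nextE]): the successor of K in
    H is generated by [K, H] and the n-th powers in K, where n is the product of
    the primes dividing the order of K.  For a pcgs refining the series, sorting
    the generators by final weight recovers the G_i ([LG_groupE]), and the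
    exponents of weight i are coordinates of G_i / G_(i+1) over F_p, on which
    alpha acts by the matrix M_i ([layer_mxP]).

    AutOrder: alpha^n acts trivially on all factors exactly when
    o = lcm(o_1, ..., o_r) divides n.  If beta = alpha^o also acts trivially on
    G / G_(i+1), then beta^m(h) is h z^m modulo G_(i+2) with z = h^-1 beta(h) in
    G_(i+1) ([power_action]), so the exponent o needed for G / G_(i+2) stays the same
    or is multiplied by p, according to whether beta moves a generator modulo
    G_(i+2) ([loop_stepP]).

    AffCycle: left translation by g turns A into x |-> w alpha(x) with
    w = g^-1 t alpha(g) and the base point into 1 ([affine_translate]).  If
    A^lambda maps g into g G_i, then its further powers move g inside g G_i, and
    in coordinates of G_i / G_(i+1) they are the iterates of v |-> M_i v + u_i
    at 0 ([layer_affine]), which gives the factor lambda_i ([affine_stepP]).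

    Subroutine: the n-th iterate of v |-> x v + S at 0 is
    (1 + x + ... + x^(n-1)) S; it vanishes modulo P exactly when it does modulo
    each primary factor Q^m of P, and multiplying by x - 1 turns this into a
    divisibility of x^n - 1 ([zero_cycle_primaryP]).  The subroutine relies on
    the rational canonical form, whose existence is proved by splitting off
    cyclic subspaces ([cyclic_complement], [rcf_exists]). *)

Set Implicit Arguments.
Unset Strict Implicit.
Unset Printing Implicit Defensive.

(** * Periods and total correctness *)

(** In contrast to minimality, this combines well: the period of a conjunction is
    the lcm of the periods, and the condition can be tested in stages. *)
Definition period (Q : nat -> Prop) (a : nat) : Prop := forall n, Q n <-> a %| n.

Lemma period_unique Q a b : period Q a -> period Q b -> a = b.
Proof.
move=> pa pb; apply/eqP; rewrite eqn_dvd.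
by apply/andP; split; [apply/pa/pb | apply/pb/pa].
Qed.

Lemma eq_period Q1 Q2 a : (forall n, Q1 n <-> Q2 n) -> period Q1 a -> period Q2 a.
Proof. by move=> eQ p1 n; rewrite -eQ. Qed.

(** The n with Q n are closed under addition and subtraction, so division with
    remainder by the least positive one applies. *)
Lemma least_pos_period Q a :
  Q 0 -> (forall m n, Q m -> Q (m + n) <-> Q n) -> least_pos Q a -> period Q a.
Proof.
move=> Q0 QD [a0 Qa amin].
have Qmul k : Q (k * a)%N by elim: k => // k IH; rewrite mulSn QD.
move=> n; split=> [Qn | /dvdnP[k ->] //].
move: Qn; rewrite {1}(divn_eq n a) QD // => Qr.
rewrite /dvdn; apply: contraT; rewrite -lt0n => r0.
by have := amin _ r0 Qr; rewrite leqNgt ltn_pmod.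
Qed.

Lemma period_least_pos Q a : 0 < a -> period Q a -> least_pos Q a.
Proof. by move=> a0 pa; split=> // [|m m0 /pa/dvdn_leq->//]; apply/pa. Qed.

Lemma ex_least_pos (Q : nat -> Prop) n : 0 < n -> Q n -> exists a, least_pos Q a.
Proof.
elim/ltn_ind: n => n IH n0 Qn.
case: (classic (exists m, [/\ 0 < m, m < n & Q m])) => [[m [m0 lmn Qm]] | noQ].
  exact: IH Qm.
exists n; split=> // m m0 Qm; rewrite leqNgt; apply/negP => lmn.
by apply: noQ; exists m.
Qed.

(** The intermediate results have no closed form; they are only pinned down by
    properties such as [period], so the rules below speak of a property of the
    result. *)
Definition returns_some (A : Type) (c : Defs.comp A) (P : A -> Prop) : Prop :=
  exists2 a, returns c a & P a.

Lemma returns_some_ret A (a : A) (P : A -> Prop) : P a -> returns_some (Ret a) P.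
Proof. by exists a. Qed.

Lemma returns_some_weaken A (c : Defs.comp A) (P P' : A -> Prop) :
  returns_some c P -> (forall a, P a -> P' a) -> returns_some c P'.
Proof. by move=> [a ca Pa] PP'; exists a => //; apply: PP'. Qed.

Lemma returns_bind A B (c : Defs.comp A) (f : A -> Defs.comp B) a b :
  returns c a -> returns (f a) b -> returns (bind c f) b.
Proof.
elim: c => [x /= -> // | C spec k IH /= [exC kC] fb].
by split=> // x Cx; apply: IH (kC x Cx) fb.
Qed.

Lemma returns_some_bind A B (c : Defs.comp A) (f : A -> Defs.comp B) P P' :
  returns_some c P -> (forall a, P a -> returns_some (f a) P') ->
  returns_some (bind c f) P'.
Proof.
move=> [a ca Pa] /(_ a Pa)[b fb P'b]; exists b => //.
exact: returns_bind ca fb.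
Qed.

(** The admissible outputs of a subroutine may differ, but all continuations meet
    the same property, which a single value has: hence they agree. *)
Lemma returns_some_call A B (spec : B -> Prop) (k : B -> Defs.comp A) (P : A -> Prop) :
  (forall a a', P a -> P a' -> a = a') -> (exists b, spec b) ->
  (forall b, spec b -> returns_some (k b) P) -> returns_some (Call spec k) P.
Proof.
move=> uniqP [b0 sb0] kP; have [a ka Pa] := kP _ sb0.
exists a => //; split=> [|b sb]; first by exists b0.
by have [a' ka' Pa'] := kP _ sb; rewrite (uniqP a a').
Qed.

Lemma returns_some_least_pos (Q : nat -> Prop) n :
  Q 0 -> (forall m n, Q m -> Q (m + n) <-> Q n) -> 0 < n -> Q n ->
  returns_some (Call (least_pos Q) (@Ret nat)) (period Q).
Proof.
move=> Q0 QD n0 Qn.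
apply: returns_some_call => [| |b lb]; first exact: period_unique.
  exact: ex_least_pos Qn.
by apply: returns_some_ret; apply: least_pos_period.
Qed.

Lemma returns_some_foldM S (f : S -> nat -> Defs.comp S) (I : nat -> S -> Prop) m k s :
  I m s ->
  (forall i s, m <= i < m + k -> I i s -> returns_some (f s i) (I i.+1)) ->
  returns_some (foldM f s (iota m k)) (I (m + k)).
Proof.
elim: k m s => [|k IH] m s Is step /=; first by rewrite addn0; exists s.
apply: returns_some_bind (step m s _ Is) _ => [|s' Is'].
  by rewrite leqnn addnS ltnS leq_addr.
rewrite addnS -addSn; apply: IH => // i t /andP[mi it]; apply: step.
by rewrite (ltnW mi) addnS -addSn.
Qed.

Lemma returns_some_lcmM (T : eqType) (f : T -> Defs.comp nat) (l : seq T)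
    (Q : T -> nat -> Prop) :
  (forall x, x \in l -> returns_some (f x) (period (Q x))) ->
  returns_some (lcmM f l) (period (fun n => forall x, x \in l -> Q x n)).
Proof.
rewrite /lcmM => fQ.
(* The accumulator o divides all further results. *)
have gen o : returns_some
    (foldM (fun o x => bind (f x) (fun m => Ret (lcmn o m))) o l)
    (period (fun n => o %| n /\ forall x, x \in l -> Q x n)).
  elim: l fQ o => [_ o | x l IH fQ o] /=.
    by apply: returns_some_ret => n; split=> [[]|].
  have [| m fm Qm] := fQ x; first by rewrite mem_head.
  apply: (@returns_some_bind _ _ _ _ (eq^~ (lcmn o m))).
    by exists (lcmn o m) => //; apply: returns_bind fm _.
  move=> _ ->; apply: returns_some_weaken (IH _ (lcmn o m)) _ => [y ly|a].
    by apply: fQ; rewrite inE ly orbT.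
  apply: eq_period => n; rewrite dvdn_lcm; split.
    case=> /andP[on /Qm Qxn] Ql; split=> // y; rewrite inE => /predU1P[-> // | ].
    exact: Ql.
  case=> on Ql; split=> [|y ly]; last by apply: Ql; rewrite inE ly orbT.
  by rewrite on; apply/Qm/Ql/mem_head.
apply: returns_some_weaken (gen 1%N) _ => a; apply: eq_period => n; split=> [[] //|].
by split.
Qed.

(** * Polynomials over finite fields *)

Section LinearAlgebra.
Import GRing.Theory.
Local Open Scope ring_scope.

Section Factor.
Variable F : fieldType.
Implicit Types P Q S : {poly F}.

Lemma monic_irreducible_divisor P : (1 < size P)%N ->
  exists Q, [/\ Q \is monic, irreducible_poly Q & Q %| P].
Proof.
move: {2}(size P) (leqnn (size P)) => n; elim: n P => [|n IH] P leP lt1.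
  by move: (leq_trans lt1 leP).
case: (classic (irreducible_poly P)) => [irrP | redP].
  have P0 := irredp_neq0 irrP.
  have lc0 : (lead_coef P)^-1 != 0 by rewrite invr_eq0 lead_coef_eq0.
  have eqP : (lead_coef P)^-1 *: P %= P by rewrite eqp_scale.
  exists ((lead_coef P)^-1 *: P); split; first by rewrite monicE lead_coefZ mulVf // lead_coef_eq0.
    split=> [|q q1 qP]; first by rewrite size_scale.
    rewrite (eqp_dvdr _ eqP) in qP.
    by apply: eqp_trans (irrP.2 q q1 qP) _; rewrite eqp_sym.
  by rewrite (eqp_dvdl _ eqP).
have [q [q1 qP neqP]] : exists q : {poly F}, [/\ size q != 1%N, q %| P & ~~ (q %= P)].
  apply: NNPP => noq; apply: redP; split=> // q q1 qP; apply: contraT => nq.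
  by case: noq; exists q.
have P0 : P != 0 by rewrite -size_poly_gt0 ltnW.
have q0 : q != 0 by apply: contraNneq P0 => q0; rewrite q0 dvd0p in qP.
have ltq : (size q < size P)%N.
  by rewrite ltn_neqAle dvdp_leq // andbT dvdp_size_eqp.
have [||Q [mQ iQ Qq]] := IH q.
- by rewrite -ltnS; apply: leq_trans ltq leP.
- by rewrite ltn_neqAle eq_sym q1 size_poly_gt0.
by exists Q; split=> //; apply: dvdp_trans qP.
Qed.

Lemma monic_factorization P : P \is monic -> exists fs, factorization_spec P fs.
Proof.
move=> mP.
have [s irrs ->] : exists2 s : seq {poly F},
    (forall q, q \in s -> q \is monic /\ irreducible_poly q) & P = \prod_(q <- s) q.
  move: {2}(size P) (leqnn (size P)) => n; elim: n P mP => [|n IH] P mP leP.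
    by move: leP; rewrite leqn0 size_poly_eq0 (negPf (monic_neq0 mP)).
  have [le1 | lt1] := leqP (size P) 1.
    exists [::] => //; rewrite big_nil; apply/eqP; rewrite -eqp_monic ?monic1 //.
    by rewrite -size_poly_eq1 eqn_leq le1 size_poly_gt0 monic_neq0.
  have [Q [mQ iQ QP]] := monic_irreducible_divisor lt1.
  have eP : P = Q * (P %/ Q) by rewrite mulrC divpK.
  have mPQ : P %/ Q \is monic by rewrite -(monicMl _ mQ) -eP.
  have [|s irrs es] := IH _ mPQ.
    rewrite -ltnS; apply: leq_trans leP.
    by rewrite size_divp ?monic_neq0 // ltn_subrL -subn1 subn_gt0 iQ.1 ltnW.
  exists (Q :: s); last by rewrite big_cons -es.
  by move=> q; rewrite inE => /predU1P[-> // | /irrs].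
exists [seq (q, count_mem q s) | q <- undup s]; split.
- by rewrite -map_comp map_id_in ?undup_uniq.
- move=> _ /mapP[q qs ->]; rewrite mem_undup in qs; have [mq iq] := irrs q qs.
  by split=> //=; rewrite -has_count has_pred1.
by rewrite big_map /= -big_undup_iterop_count.
Qed.

Lemma irreducible_coprime P Q :
  irreducible_poly P -> P \is monic -> irreducible_poly Q -> Q \is monic ->
  P != Q -> coprimep P Q.
Proof.
move=> iP mP iQ mQ neq; rewrite coprimep_def.
have [// | ne1] := eqVneq (size (gcdp P Q)) 1%N.
have e1 := iP _ ne1 (dvdp_gcdl _ _); have e2 := iQ _ ne1 (dvdp_gcdr _ _).
rewrite eqp_sym in e1; move: (eqp_trans e1 e2).
by rewrite eqp_monic // (negPf neq).
Qed.

Lemma irreducible_coprimeP P Q : irreducible_poly P -> ~~ (P %| Q) -> coprimep P Q.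
Proof.
move=> iP nPQ; rewrite coprimep_def; apply: contraR nPQ => ne1.
have := iP _ ne1 (dvdp_gcdl _ _); rewrite eqp_sym => /eqp_dvdl->.
exact: dvdp_gcdr.
Qed.

(** The primary factors of a factorization are pairwise coprime, so a property can
    be assembled from them two coprime pieces at a time. *)
Lemma factorization_ind (V : {poly F} -> Prop) P fs :
  factorization_spec P fs -> V 1 ->
  (forall f, f \in fs -> V (f.1 ^+ f.2)) ->
  (forall P1 P2, coprimep P1 P2 -> V P1 -> V P2 -> V (P1 * P2)) -> V P.
Proof.
case=> uq irr -> V1 Vf VM; elim: fs uq irr Vf => [|f fs IH] uq irr Vf.
  by rewrite big_nil.
have sub g : g \in fs -> g \in f :: fs by rewrite inE orbC => ->.
rewrite big_cons; have [mf irf _] := irr f (mem_head _ _).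
case/andP: uq => nf uq.
apply: VM; [|exact: Vf (mem_head _ _)|]; last first.
  by apply: IH uq _ _ => g /sub; [apply: irr | apply: Vf].
rewrite big_seq; elim/big_rec: _ => [|g Q gfs coQ]; first exact: coprimep1.
have [mg ig _] := irr g (sub g gfs).
rewrite coprimepMr coQ andbT coprimep_expl // coprimep_expr //.
apply: irreducible_coprime => //; apply: contraNneq nf => ->.
exact: map_f.
Qed.

Lemma factorization_dvdp P fs Q : factorization_spec P fs ->
  P %| Q <-> forall f, f \in fs -> f.1 ^+ f.2 %| Q.
Proof.
move=> facP; split=> [PQ f ffs | allQ].
  apply: dvdp_trans PQ; case: facP => _ _ ->.
  by rewrite (big_rem f ffs) dvdp_mulr.
apply: (factorization_ind (V := fun D => D %| Q) facP) => // [|D1 D2 co d1 d2].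
  exact: dvd1p.
by rewrite Gauss_dvdp // d1.
Qed.

(** A divisor of a power of an irreducible Q is either associate to it, or its
    cofactor is divisible by Q and can be lowered by one factor Q. *)
Lemma dvdp_primary Q m P : irreducible_poly Q -> P %| Q ^+ m.+1 ->
  P %= Q ^+ m.+1 \/ P %| Q ^+ m.
Proof.
move=> iQ PQ; have Q0 := irredp_neq0 iQ.
have [k kP] : exists k, Q ^+ m.+1 = k * P by exists (Q ^+ m.+1 %/ P); rewrite divpK.
have Qm0 : Q ^+ m.+1 != 0 by rewrite expf_neq0.
have [P0 k0] : P != 0 /\ k != 0.
  by split; apply: contraNneq Qm0 => e0; rewrite kP e0 ?mul0r ?mulr0.
have [Qk | nQk] := boolP (Q %| k).
  right; rewrite -(dvdp_mul2l _ _ Q0) -exprS kP dvdp_mul2r //.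
left; rewrite /eqp PQ /= -(Gauss_dvdpr _ (coprimep_expl m.+1 (irreducible_coprimeP iQ nQk))).
by rewrite -kP.
Qed.

(** The n-th iterate of v |-> x v + S at 0 is [geometric n] times S. *)
Definition geometric n : {poly F} := \sum_(i < n) 'X^i.

Lemma geometricE n : ('X - 1) * geometric n = 'X^n - 1.
Proof. by rewrite /geometric -subrX1. Qed.

Lemma geometricS n : geometric n.+1 = 1 + 'X * geometric n.
Proof.
rewrite /geometric big_ord_recl expr0 mulr_sumr; congr (_ + _).
by apply: eq_bigr => i _; rewrite exprS.
Qed.

End Factor.
Arguments geometric {F} n.

Section PolyOrder.
Variable F : finFieldType.
Implicit Types P Q S : {poly F}.

(** There are finitely many remainders modulo P, so two powers of x agree modulo
    P, and x is invertible modulo P. *)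
Lemma poly_order_exists P : coprimep P 'X ->
  exists2 n, (0 < n)%N & P %| 'X^n - 1.
Proof.
move=> coPX; pose k := size P.
have P0 : P != 0.
  by apply: contraTneq coPX => ->; rewrite /coprimep gcd0p size_polyX.
pose f (i : 'I_#|'rV[F]_k|.+1) : 'rV[F]_k := poly_rV ('X^i %% P).
(* f has one more argument than there are values. *)
have /injectivePn[i [j neq eqf]] : ~~ injectiveb f.
  apply/negP => /injectiveP/leq_card; rewrite card_ord ltnn //.
wlog ltij : i j neq eqf / (i < j)%N => [WL|].
  by have := neq; rewrite -val_eqE neq_ltn => /orP[]; apply: WL; rewrite // eq_sym.
exists (j - i)%N; first by rewrite subn_gt0.
have: P %| 'X^j - 'X^i.
  rewrite /dvdp modpD modpN; have /(congr1 rVpoly) := eqf.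
  by rewrite !poly_rV_K ?(ltnW (ltn_modpN0 _ P0)) // => ->; rewrite subrr.
rewrite -{1}(subnKC (ltnW ltij)) exprD -{2}['X^i]mulr1 -mulrBr.
by rewrite Gauss_dvdpr // coprimep_expr.
Qed.

Lemma poly_orderP P : coprimep P 'X ->
  returns_some (poly_order P) (period (fun n => P %| 'X^n - 1)).
Proof.
move=> coPX; have [n n0 Pn] := poly_order_exists coPX.
apply: returns_some_least_pos n0 Pn => [|a b Pa]; first by rewrite subrr dvdp0.
have -> : 'X^(a + b) - 1 = 'X^b * ('X^a - 1) + ('X^b - 1) :> {poly F}.
  by rewrite mulrBr mulr1 addrA subrK exprD mulrC.
by rewrite dvdp_addr // dvdp_mull.
Qed.

(** Cancelling the part Q^v of S that is not coprime to Q leaves the condition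
    Q^(m-v) | 1 + ... + x^(n-1).  Multiplication by x - 1 turns the right side
    into x^n - 1; it is harmless if Q is coprime to x - 1 and adds one factor Q
    otherwise. *)
Lemma zero_cycle_primaryP S Q m : irreducible_poly Q -> Q \is monic -> coprimep Q 'X ->
  returns_some (zero_cycle_primary S Q m)
               (period (fun n => Q ^+ m %| geometric n * S)).
Proof.
move=> iQ mQ coQX; rewrite /zero_cycle_primary; case: ifPn => [QS | nQS].
  by apply: returns_some_ret => n; rewrite dvd1n dvdp_mull.
set v := \max_(k < m | _) _.
have m0 : (0 < m)%N by rewrite lt0n; apply: contraNneq nQS => ->; rewrite expr0 dvd1p.
have [k Qk ev] : exists2 k : 'I_m, Q ^+ k %| S & v = k.
  have [|k Qk ek] := @eq_bigmax_cond _ [pred k : 'I_m | Q ^+ k %| S] (@nat_of_ord m).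
    by apply/card_gt0P; exists (Ordinal m0); rewrite inE /= expr0 dvd1p.
  by exists k => //; rewrite /v -ek; apply: eq_bigl => i; rewrite inE.
have ltvm : (v < m)%N by rewrite ev.
have [S' eS] : exists S', S = S' * Q ^+ v by exists (S %/ Q ^+ v); rewrite divpK // ev.
(* The maximum runs over k < m only, but Q^m does not divide S. *)
have nQS' : ~~ (Q %| S').
  apply/negP => QS'; have QvS : Q ^+ v.+1 %| S.
    by rewrite eS exprS dvdp_mul2r // expf_neq0 // monic_neq0.
  have [lt | ge] := ltnP v.+1 m.
    have: (v.+1 <= v)%N by rewrite {2}/v (bigmax_sup (Ordinal lt)).
    by rewrite ltnn.
  have em : v.+1 = m by apply/eqP; rewrite eqn_leq ltvm ge.
  by rewrite -em QvS in nQS.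
apply: returns_some_weaken (poly_orderP _) _ => [|a]; first by rewrite coprimep_expl.
apply: eq_period => n; rewrite eS.
have Qv0 : Q ^+ v != 0 by rewrite expf_neq0 // monic_neq0.
have em : Q ^+ m = Q ^+ (m - v) * Q ^+ v by rewrite -exprD subnK // ltnW.
rewrite mulrA em dvdp_mul2r //.
rewrite Gauss_dvdpl ?coprimep_expl ?irreducible_coprimeP // -geometricE.
case: eqP => [-> | /eqP neq]; first by rewrite addn1 exprS dvdp_mul2l // polyXsubC_eq0.
rewrite addn0 Gauss_dvdpr // coprimep_expl // irreducible_coprime //.
  by rewrite -polyC1; apply: irredp_XsubC.
by rewrite -polyC1 monicXsubC.
Qed.

Lemma zero_cycle_companionP P S : P \is monic -> coprimep P 'X ->
  returns_some (zero_cycle_companion P S) (period (fun n => P %| geometric n * S)).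
Proof.
move=> mP coPX; apply: returns_some_call => [||fs facP]; first exact: period_unique.
  exact: monic_factorization.
apply: returns_some_weaken.
  apply: (returns_some_lcmM (Q := fun f n => f.1 ^+ f.2 %| geometric n * S)) => f ffs.
  case: (facP) => _ /(_ f ffs)[mf irf f0] eP.
  apply: zero_cycle_primaryP => //; apply: coprimep_dvdr coPX.
  by rewrite eP (big_rem f ffs) dvdp_mulr // -(prednK f0) exprS dvdp_mulr.
by move=> a; apply: eq_period => n; rewrite (factorization_dvdp _ facP).
Qed.
End PolyOrder.

(** * Decomposition into cyclic subspaces *)

Section Krylov.
Variables (F : fieldType) (n : nat) (N : 'M[F]_n.+1).
Implicit Types (v : 'rV[F]_n.+1) (P Q : {poly F}) (U : 'M[F]_n.+1).

Local Notation act v Q := (v *m horner_mx N Q).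

Lemma act_mul m (v : 'M_(m, n.+1)) P Q : act v (P * Q) = act (act v P) Q.
Proof. by rewrite rmorphM /= mulmxA. Qed.

Lemma act_sub v U P : stablemx U N -> (v <= U)%MS -> (act v P <= U)%MS.
Proof.
by move=> sU vU; apply: submx_trans (submxMr _ vU) _; apply: horner_mx_stable.
Qed.

Definition annihilated_by m (v : 'M_(m, n.+1)) P := forall Q, act v Q = 0 <-> P %| Q.

(** A polynomial of least degree killing A, made monic: remainders modulo it
    again kill A. *)
Lemma annihilator_exists m (A : 'M_(m, n.+1)) :
  exists2 P, P \is monic & annihilated_by A P.
Proof.
have [k [P [ltk P0 AP]] kmin] : exists2 k,
    exists P, [/\ (size P <= k)%N, P != 0 & act A P = 0] &
    forall P, P != 0 -> act A P = 0 -> (k <= size P)%N.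
  have [||a [a0 [P [P0 AP sP]] amin]] := @ex_least_pos
    (fun k => exists P, [/\ P != 0, act A P = 0 & (size P <= k)%N]) (size (char_poly N)).
  - by rewrite size_char_poly.
  - exists (char_poly N); split=> //; first exact: monic_neq0 (char_poly_monic N).
    by rewrite Cayley_Hamilton mulmx0.
  exists a; first by exists P.
  move=> Q Q0 AQ; apply: amin; first by rewrite size_poly_gt0.
  by exists Q.
have lc0 : (lead_coef P)^-1 != 0 by rewrite invr_eq0 lead_coef_eq0.
have AP' : act A ((lead_coef P)^-1 *: P) = 0 by rewrite linearZ /= -scalemxAr AP scaler0.
exists ((lead_coef P)^-1 *: P); first by rewrite monicE lead_coefZ mulVf // lead_coef_eq0.
move=> Q; rewrite dvdpZl //; split=> [AQ | /dvdpP[q ->]]; last first.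
  by rewrite mulrC act_mul AP mul0mx.
rewrite /dvdp; apply: contraT => r0.
have /(kmin _ r0) : act A (Q %% P) = 0.
  move: AQ; rewrite {1}(divp_eq Q P) rmorphD mulmxDr mulrC act_mul AP mul0mx add0r.
  by [].
by rewrite leqNgt (leq_trans _ ltk) // ltn_modp.
Qed.

(** Some vector of U is annihilated by no more polynomials than U itself.  For a
    primary factor q^k of P, a row of U that is not killed by P / q becomes,
    after applying P / q^k, a vector with annihilator q^k; vectors with coprime
    annihilators add up to one with the product as annihilator. *)
Lemma maximal_vector U P : stablemx U N -> P \is monic -> annihilated_by U P ->
  exists2 v : 'rV_n.+1, (v <= U)%MS & annihilated_by v P.
Proof.
move=> sU mP annU; have [fs facP] := monic_factorization mP.
apply: (factorization_ind
         (V := fun D => exists2 v : 'rV_n.+1, (v <= U)%MS & annihilated_by v D) facP).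
- exists 0; first exact: sub0mx.
  by move=> Q; rewrite mul0mx dvd1p.
- move=> f ffs; case: facP => _ /(_ f ffs)[mf irf f0] eP.
  have [R eR] : exists R, P = R * f.1 ^+ f.2.
    by exists (\prod_(y <- rem f fs) y.1 ^+ y.2); rewrite eP (big_rem f ffs) mulrC.
  have P0 := monic_neq0 mP.
  have R0 : R != 0 by apply: contraNneq P0 => R0; rewrite eR R0 mul0r.
  pose R' := R * f.1 ^+ f.2.-1.
  have [i ni0] : exists i, row i (act U R') != 0.
    have: act U R' != 0.
      apply/eqP => /annU; rewrite eR /R' dvdp_mul2l //.
      by rewrite dvdp_Pexp2l ?irf.1 // -ltnS prednK // ltnn.
    by case/rowV0Pn => w /submxP[D ->]; case: (boolP [exists i, row i (act U R') != 0])
      => [/existsP // | /existsPn no0]; rewrite (_ : act U R' = 0) ?mulmx0 ?eqxx //;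
      apply/row_matrixP => i; rewrite row0; apply/eqP; have := no0 i; rewrite negbK.
  exists (act (row i U) R); first by apply: act_sub => //; apply: row_sub.
  move=> Q; split=> [wQ|]; last first.
    move/dvdpP=> [q ->]; rewrite -act_mul mulrCA -eR mulrC -row_mul.
    by rewrite act_mul (iffRL (annU P)) // mul0mx row0.
  have [D mD annD] := annihilator_exists (act (row i U) R).
  have DQ : D %| Q by apply/annD.
  apply: dvdp_trans DQ.
  have : D %| f.1 ^+ f.2.
    by apply/annD; rewrite -act_mul -eR -row_mul (iffRL (annU P)) // row0.
  rewrite -(prednK f0) => /(dvdp_primary irf)[].
    by rewrite eqp_sym /eqp => /andP[].
  move/annD; rewrite -act_mul -row_mul => e0; by rewrite e0 eqxx in ni0.
move=> D1 D2 co [v1 v1U a1] [v2 v2U a2]; exists (v1 + v2); first exact: addmx_sub.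
move=> Q; rewrite Gauss_dvdp //; split=> [aQ | /andP[/a1 e1 /a2 e2]]; last first.
  by rewrite mulmxDl e1 e2 addr0.
apply/andP; split.
  rewrite -(Gauss_dvdpr _ co); apply/a1.
  have: act (v1 + v2) (D2 * Q) = 0 by rewrite mulrC act_mul aQ mul0mx.
  by rewrite mulmxDl [act v2 _](iffRL (a2 _)) ?addr0 // dvdp_mulr.
rewrite -(@Gauss_dvdpr _ _ D1); last by rewrite coprimep_sym.
apply/a2; have: act (v1 + v2) (D1 * Q) = 0 by rewrite mulrC act_mul aQ mul0mx.
by rewrite mulmxDl [act v1 _](iffRL (a1 _)) ?add0r // dvdp_mulr.
Qed.

Definition krylov (v : 'rV[F]_n.+1) d : 'M_(d, n.+1) := \matrix_(i < d) (v *m N ^+ i).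

(** Linear combinations of Krylov rows are values of polynomials in N at v. *)
Lemma mul_krylov v d (w : 'rV_d) : w *m krylov v d = act v (rVpoly w).
Proof.
rewrite mulmx_sum_row /rVpoly poly_def rmorph_sum mulmx_sumr.
apply: eq_bigr => i _; rewrite rowK /= linearZ /= rmorphXn /= horner_mx_X.
by rewrite -scalemxAr; case: insubP => [j _ /= /ord_inj -> | /negP[]].
Qed.

Lemma krylov_free v P d : annihilated_by v P -> (d < size P)%N -> row_free (krylov v d).
Proof.
move=> annv ltd; apply: inj_row_free => w; rewrite mul_krylov => /annv Pw.
have w0 : rVpoly w = 0.
  apply/eqP; apply: contraTT ltd => nw; rewrite -leqNgt.
  exact: leq_trans (dvdp_leq nw Pw) (size_poly _ _).
by rewrite -(rVpolyK w) w0 linear0.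
Qed.

(** The cyclic subspace of a vector v whose annihilator P kills all of U has an
    N-stable complement in U.  Choose a linear form c that is the leading
    coordinate on v, ..., v N^(d-1) and let the complement consist of the x in U
    with x N^i c = 0 for i < d.  As P kills U, this holds for all i, so the
    complement is stable; it meets the cyclic subspace trivially and is cut out
    by only d equations. *)
Lemma cyclic_complement U P v (d := (size P).-1) : stablemx U N -> P \is monic ->
  (1 < size P)%N -> act U P = 0 -> (v <= U)%MS -> annihilated_by v P ->
  exists U' : 'M_n.+1, [/\ stablemx U' N, (U' <= U)%MS, (d + \rank U' = \rank U)%N
                  & (U <= krylov v d + U')%MS].
Proof.
move=> sU mP ltP UP vU annv.
have d0 : (0 < d)%N by rewrite /d -subn1 subn_gt0.
have sP : size P = d.+1 by rewrite /d prednK // ltnW.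
have Kfree : row_free (krylov v d) by apply: krylov_free annv _; rewrite sP.
(* The linear form c; it exists as the Krylov rows are independent. *)
have [c vc] : exists c : 'cV[F]_n.+1,
    forall i, (i < d)%N -> v *m N ^+ i *m c = (i == d.-1)%:R%:M.
  exists (pinvmx (krylov v d) *m \col_i (i == d.-1 :> nat)%:R) => i ltid.
  have <- : row (Ordinal ltid) (krylov v d) = v *m N ^+ i by rewrite rowK.
  rewrite -row_mul mulmxA mulmxVp // mul1mx.
  by apply/matrixP=> a b; rewrite !mxE !ord1 eqxx mulr1n.
pose L : 'M_(n.+1, d) := \matrix_(k < n.+1, i < d) (N ^+ i *m c) k 0.
have kerL (x : 'rV_n.+1) : (x <= kermx L)%MS <-> forall i, (i < d)%N -> x *m N ^+ i *m c = 0.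
  have xL : x *m L = \row_(i < d) (x *m N ^+ i *m c) 0 0.
    apply/rowP=> i; rewrite [RHS]mxE -mulmxA [LHS]mxE [RHS]mxE.
    by apply: eq_bigr => k _; rewrite [L k i]mxE.
  rewrite (sameP sub_kermxP eqP) xL; split=> [/eqP/rowP x0 i ltid | x0].
    apply/matrixP => a b; rewrite !ord1; have := x0 (Ordinal ltid).
    by rewrite !mxE.
  by apply/eqP/rowP => i; rewrite [LHS]mxE x0 // !mxE.
have kerP (x : 'rV_n.+1) : (x <= U)%MS -> (x <= kermx L)%MS ->
    forall Q, act x Q *m c = 0.
  move=> xU /kerL x0 Q.
  have xP : act x P = 0 by case/submxP: xU => D ->; rewrite -mulmxA UP mulmx0.
  have -> : act x Q = act x (Q %% P).
    by rewrite {1}(divp_eq Q P) rmorphD mulmxDr mulrC act_mul xP mul0mx add0r.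
  have : (size (Q %% P)%R <= d)%N by rewrite -ltnS -sP ltn_modp monic_neq0.
  move=> /poly_rV_K <-; rewrite -mul_krylov [_ *m krylov _ _]mulmx_sum_row mulmx_suml
    big1 // => i _.
  by rewrite rowK -scalemxAl x0 // scaler0.
pose U' := (U :&: kermx L)%MS.
have U'U : (U' <= U)%MS by apply: capmxSl.
have sU' : stablemx U' N.
  apply/rV_subP => _ /submxP[D ->].
  rewrite mulmxA; set x := D *m U'.
  have xU' : (x <= U')%MS by apply: submxMl.
  have [xU xL] : (x <= U)%MS /\ (x <= kermx L)%MS by move: xU'; rewrite sub_capmx => /andP[].
  have xNU : (x *m N <= U)%MS by apply: submx_trans (submxMr _ xU) sU.
  rewrite sub_capmx xNU /=; apply/kerL => i ltid.
  have := kerP x xU xL 'X^(i.+1).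
  by rewrite rmorphXn /= horner_mx_X exprS -mulmxE !mulmxA.
have KU : (krylov v d <= U)%MS.
  apply/row_subP => i; rewrite rowK -[N](horner_mx_X N) -rmorphXn /=.
  exact: act_sub.
have cap0 : (krylov v d :&: U')%MS = 0.
  apply/eqP/rowV0P => x; rewrite sub_capmx => /andP[/submxP[w ex] xU'].
  have [xU xL] : (x <= U)%MS /\ (x <= kermx L)%MS by move: xU'; rewrite sub_capmx => /andP[].
  rewrite mul_krylov in ex; pose Q := rVpoly w.
  have [Q0 | Q0] := eqVneq Q 0; first by rewrite ex -/Q Q0 rmorph0 mulmx0.
  (* Shifting Q to degree d - 1 makes c read off its leading coefficient. *)
  have leQ : (size Q <= d)%N by apply: size_poly.
  have eqQ : (size (Q * 'X^(d - size Q))%R = d)%N.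
    by rewrite size_mulXn // subnK.
  have /eqP : act v (Q * 'X^(d - size Q)) *m c = 0 by rewrite act_mul -ex; apply: kerP.
  rewrite -(@poly_rV_K _ d (Q * _)) ?eqQ // -mul_krylov [_ *m krylov _ _]mulmx_sum_row mulmx_suml.
  have ltd1 : (d.-1 < d)%N by rewrite prednK.
  rewrite (bigD1 (Ordinal ltd1)) //= big1 => [|i ni]; last first.
    rewrite rowK -scalemxAl vc //; move: ni; rewrite -val_eqE /= => /negPf->.
    by rewrite raddf0 scaler0.
  rewrite rowK -scalemxAl vc // eqxx addr0 mxE scale_scalar_mx mulr1.
  have -> : (Q * 'X^(d - size Q))`_d.-1 = lead_coef Q.
    transitivity (lead_coef (Q * 'X^(d - size Q))); first by rewrite lead_coefE eqQ.
    by rewrite lead_coef_Mmonic ?monicXn.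
  move=> /eqP/matrixP/(_ 0 0); rewrite !mxE eqxx mulr1n => /eqP.
  by rewrite lead_coef_eq0 (negPf Q0).
have rk : (d + \rank U')%N = \rank (krylov v d + U')%MS.
  by have := mxrank_sum_cap (krylov v d) U'; rewrite cap0 mxrank0 addn0 (eqP Kfree).
have KU'U : (krylov v d + U' <= U)%MS by rewrite addsmx_sub KU.
have rkU : (\rank U <= d + \rank U')%N.
  by rewrite -(mxrank_mul_ker U L) leq_add2r rank_leq_col.
exists U'; split=> //.
  by apply/eqP; rewrite eqn_leq rkU andbT rk mxrankS.
by move: (mxrank_leqif_sup KU'U) => /leqifP; case: ifP => // _; rewrite -rk ltnNge rkU.
Qed.

(** Each listed vector v comes with a polynomial P killing it; the rank condition
    and the last condition make the rows v N^i with i < deg P a basis of U.  That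
    P divides every polynomial killing U is what keeps the divisibility chain
    going when U is enlarged. *)
Definition cyclic_decomposition U (l : seq ('rV[F]_n.+1 * {poly F})) :=
  [/\ forall x, x \in l -> [/\ x.2 \is monic, (1 < size x.2)%N, act x.1 x.2 = 0
                      & forall Q, act U Q = 0 -> x.2 %| Q],
      pairwise (fun x y => x.2 %| y.2) l,
      (\sum_(x <- l) (size x.2).-1)%N = \rank U
    & (U <= \sum_(x <- l) <<krylov x.1 (size x.2).-1>>)%MS].

Lemma cyclic_decomposition_exists U : stablemx U N -> exists l, cyclic_decomposition U l.
Proof.
move: {2}(\rank U) (leqnn (\rank U)) => m; elim: m U => [|m IH] U leU sU.
  exists [::]; split=> //; first by rewrite big_nil; apply/eqP; rewrite eq_sym -leqn0.
  by move: leU; rewrite leqn0 mxrank_eq0 => /eqP->; apply: sub0mx.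
have [/eqP rU0 | rU] := posnP (\rank U).
  exists [::]; split=> //; first by rewrite big_nil (eqP rU0).
  by move: rU0; rewrite mxrank_eq0 => /eqP->; apply: sub0mx.
have [P mP annU] := annihilator_exists U.
have UP : act U P = 0 by apply/annU.
have ltP : (1 < size P)%N.
  rewrite ltnNge; apply/negP => le1; have : P %| 1.
    rewrite (_ : P = 1) //; apply/eqP; rewrite -eqp_monic ?monic1 //.
    by rewrite -size_poly_eq1 eqn_leq le1 size_poly_gt0 monic_neq0.
  move/annU; rewrite rmorph1 mulmx1 => U0.
  by rewrite U0 mxrank0 in rU.
have [v vU annv] := maximal_vector sU mP annU.
have [U' [sU' U'U rk sup]] := cyclic_complement sU mP ltP UP vU annv.
have [||l [lP lpw lrk lsup]] := IH U' => //.
  rewrite -ltnS; apply: leq_trans leU.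
  by rewrite -rk -[X in (X < _)%N]add0n ltn_add2r -subn1 subn_gt0.
have U'0 Q : act U Q = 0 -> act U' Q = 0.
  by case/submxP: U'U => D -> UQ; rewrite -mulmxA UQ mulmx0.
exists (rcons l (v, P)); split.
- move=> x; rewrite mem_rcons inE => /predU1P[-> /= | /lP[m1 s1 a1 d1]].
    by split=> // [|Q /annU //]; apply/annv.
  by split=> // Q /U'0/d1.
- rewrite pairwise_rcons lpw andbT; apply/allP => x /lP[_ _ _ ->] //.
  exact: U'0.
- by rewrite -cats1 big_cat big_seq1 /= lrk addnC.
rewrite -cats1 big_cat big_seq1 /=; apply: submx_trans sup _.
by rewrite addsmxC addsmxS // genmxE.
Qed.
End Krylov.

(** * Rational canonical form and zero cycles *)

Section Rcf.
Variable F : fieldType.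
Implicit Types P Q : {poly F}.

(** The companion matrix multiplies by x modulo P. *)
Lemma rVpoly_companion P (w : 'rV_((size P).-1)) : P \is monic ->
  rVpoly (w *m companionmx P) = ('X * rVpoly w) %% P.
Proof.
move=> mP.
have step (i : 'I_(size P).-1) :
    rVpoly (delta_mx 0 i *m companionmx P : 'rV_((size P).-1)) =
    ('X * rVpoly (delta_mx 0 i : 'rV_((size P).-1))) %% P.
  have sP : size P = (size P).-1.+1 by rewrite prednK // size_poly_gt0 monic_neq0.
  rewrite rVpoly_delta -exprS.
  have [ltid | geid] := ltnP i.+1 (size P).-1.
    rewrite mulmx_delta_companion rVpoly_delta /= modp_small // size_polyXn.
    by rewrite -ltn_predRL.
  have ed : i.+1 = (size P).-1 by apply/eqP; rewrite eqn_leq ltn_ord geid.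
  have eX : 'X^(i.+1) = 1 * P + rVpoly (delta_mx 0 i *m companionmx P : 'rV_((size P).-1)).
    apply/polyP => j; rewrite mul1r coefD coefXn coef_rVpoly -rowE.
    case: insubP => [k _ <- | ].
      have -> : (val k == i.+1) = false by rewrite ltn_eqF // ed ltn_ord.
      by rewrite !mxE (_ : val i == _) ?subrr // -eqSS ed prednK // -ed.
    rewrite -leqNgt leq_eqVlt => /orP[/eqP <- | ltj].
      by rewrite ed eqxx addr0 -lead_coefE (monicP mP).
    by rewrite ed gtn_eqF // nth_default ?addr0 // sP.
  by rewrite eX modpD mul1r modpp add0r modp_small // [X in (_ < X)%N]sP ltnS size_poly.
rewrite [in LHS](row_sum_delta w) [in RHS](row_sum_delta w) mulmx_suml !linear_sum /= mulr_sumr.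
elim/big_ind2: _ => [|A B C D -> ->|i _]; rewrite ?mod0p ?modpD //.
by rewrite -scalemxAl !linearZ /= step -scalerAr modpZl.
Qed.

Lemma companion_krylov n (N : 'M[F]_n.+1) v P :
  P \is monic -> v *m horner_mx N P = 0 ->
  companionmx P *m krylov N v (size P).-1 = krylov N v (size P).-1 *m N.
Proof.
move=> mP vP; apply/row_matrixP => i; rewrite !rowE !mulmxA !mul_krylov.
rewrite rVpoly_companion //; set w := rVpoly _.
have -> : v *m horner_mx N w *m N = v *m horner_mx N ('X * w).
  by rewrite [_ * w]mulrC act_mul horner_mx_X.
rewrite [in RHS](divp_eq ('X * w) P) rmorphD mulmxDr [_ * P]mulrC.
by rewrite act_mul vP mul0mx add0r.
Qed.

(** The Krylov rows of a cyclic decomposition for the transpose of M are the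
    columns of the base change matrix. *)
Lemma rcf_exists d (M : 'M[F]_d) : exists C : rcf_data F d, rcf_spec M C.
Proof.
have [l [ps [K [e [lP lpw KM Kfull]]]]] : exists l (ps : 'I_l -> {poly F})
    (K : forall i, 'M[F]_((size (ps i)).-1, d)) (e : (\sum_i (size (ps i)).-1 = d)%N),
    [/\ forall i, ps i \is monic /\ (1 < size (ps i))%N,
        forall i j : 'I_l, (i <= j)%N -> ps i %| ps j,
        forall i, companionmx (ps i) *m K i = K i *m M^T
      & row_full (\mxcol_i K i)].
  (* [horner_mx] presupposes a positive dimension. *)
  case: d M => [|n] M.
    have e : (\sum_(i < 0) (size (0%R : {poly F})).-1 = 0)%N by rewrite big_ord0.
    exists 0%N, (fun=> 0 : {poly F}), (fun=> 0%R), e.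
    by split=> [[]|[]|[]|] //; rewrite /row_full -leqn0 rank_leq_col.
  have [l [lP lpw lrk lsup]] := @cyclic_decomposition_exists F n M^T 1%:M (submx1 _).
  pose x0 : 'rV[F]_n.+1 * {poly F} := (0, 0).
  have mem (i : 'I_(size l)) : nth x0 l i \in l by apply: mem_nth.
  have e : (\sum_(i < size l) (size (nth x0 l i).2).-1 = n.+1)%N.
    by rewrite -[RHS](mxrank1 F) -lrk (big_nth x0) big_mkord.
  exists (size l), (fun i => (nth x0 l i).2),
    (fun i => krylov M^T (nth x0 l i).1 (size (nth x0 l i).2).-1), e; split.
  - by move=> i; have [] := lP _ (mem i).
  - move=> i j; rewrite leq_eqVlt => /orP[/eqP/ord_inj -> // | ltij].
    by move/(pairwiseP x0): lpw; apply; rewrite ?inE.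
  - by move=> i; have [? _ ? _] := lP _ (mem i); apply: companion_krylov.
  rewrite -sub1mx; apply: submx_trans lsup _.
  rewrite (big_nth x0) big_mkord; apply/sumsmx_subP => i _; rewrite genmxE.
  set K := fun i : 'I_(size l) => krylov _ _ _.
  rewrite -/(K i) -[K i](mxcolK K); apply/row_subP => j.
  by rewrite row_rowsub row_sub.
pose C := RcfData e (castmx (e, erefl d) (\mxcol_i K i))^T.
exists C; rewrite /rcf_spec /C /=.
have KD : \mxdiag_i companionmx (ps i) *m \mxcol_i K i = \mxcol_i K i *m M^T.
  by rewrite mul_mxdiag_mxcol mxcol_mul; apply: eq_mxcol.
have -> : castmx (e, e) (\mxdiag_i companion (ps i)) =
          (castmx (e, e) (\mxdiag_i companionmx (ps i)))^T.
  by rewrite trmx_cast tr_mxdiag.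
move: KD Kfull {C KM}. move: (\mxdiag_i _) (\mxcol_i _) => D S.
case: _ / e M D S => M D S; rewrite !castmx_id => DS Sfull.
have uS : S \in unitmx by rewrite -row_full_unit.
split=> //=; first by rewrite unitmx_tr.
have MS : M *m S^T = S^T *m D^T by rewrite -trmx_mul DS trmx_mul trmxK.
by rewrite -mulmxA MS mulKmx // unitmx_tr.
Qed.

End Rcf.

Definition affine_step (F : fieldType) d (M : 'M[F]_d) (u v : 'cV[F]_d) := M *m v + u.

Lemma iter_affine_conj (F : fieldType) d (M T : 'M[F]_d) u n : T \in unitmx ->
  iter n (affine_step (invmx T *m M *m T) (invmx T *m u)) 0 =
  invmx T *m iter n (affine_step M u) 0.
Proof.
move=> uT; elim: n => [|n /= ->]; first by rewrite mulmx0.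
by rewrite /affine_step mulmxDr -!mulmxA mulKVmx.
Qed.

Lemma iter_affine_mxdiag (F : fieldType) k (ds : 'I_k -> nat)
    (Ms : forall i, 'M[F]_(ds i)) (u : 'cV_(\sum_i ds i)) n i :
  submxcol (iter n (affine_step (\mxdiag_i Ms i) u) 0) i =
  iter n (affine_step (Ms i) (submxcol u i)) 0.
Proof.
elim: n => [|n IH] /=; first by rewrite submxcol0.
rewrite /affine_step submxcolD -IH; congr (_ + _).
by rewrite -{1}(submxcolK (iter n _ _)) mul_mxdiag_mxcol mxcolK.
Qed.

(** On a companion block, the iteration takes place in F[x] / (P), at x. *)
Lemma iter_affine_companion (F : fieldType) (P : {poly F}) (u : 'cV_((size P).-1)) n :
  P \is monic ->
  (iter n (affine_step (companion P) u) 0 == 0) =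
  (P %| geometric n * rVpoly u^T).
Proof.
move=> mP; have P0 := monic_neq0 mP.
have ltP (w : 'rV[F]_((size P).-1)) : (size (rVpoly w) < size P)%N.
  by rewrite -[X in (_ < X)%N]prednK ?size_poly_gt0 // ltnS size_poly.
have -> : (P %| geometric n * rVpoly u^T) =
    (rVpoly (iter n (affine_step (companion P) u) 0)^T == 0).
  rewrite /dvdp; congr (_ == 0); elim: n => [|n IH].
    by rewrite /geometric big_ord0 mul0r mod0p trmx0 linear0.
  rewrite geometricS mulrDl mul1r -mulrA /= /affine_step linearD /= trmx_mul trmxK.
  rewrite linearD /= rVpoly_companion // -IH addrC.
  by rewrite modp_mul modpD [rVpoly u^T %% _]modp_small.
apply/eqP/eqP => [-> | /(congr1 (fun q => (poly_rV q : 'rV_((size P).-1))^T))].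
  by rewrite trmx0 linear0.
by rewrite /= rVpolyK trmxK linear0 trmx0.
Qed.

Section ZeroCycle.
Variables (F : finFieldType) (d : nat) (M : 'M[F]_d).

(** If x divided the polynomial of a block, then that block, and hence M, would
    have a nonzero kernel. *)
Lemma rcf_poly_coprimeX C i : rcf_spec M C -> M \in unitmx -> coprimep (rcf_poly C i) 'X.
Proof.
case: C i => k ps e T /= i [/= mon _ uT eM] uM; have [mi lt1] := mon i.
have uD : \mxdiag_i companion (ps i) \in unitmx.
  have : castmx (e, e) (\mxdiag_i companion (ps i)) \in unitmx.
    by rewrite -eM !unitmx_mul unitmx_inv uT uM.
  by case: _ / e (\mxdiag_i _) {T uT eM} => D; rewrite castmx_id.
rewrite coprimep_sym; have iX : irreducible_poly ('X : {poly F}).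
  by rewrite -['X]subr0 -polyC0; apply: irredp_XsubC.
apply: irreducible_coprimeP => //; apply/negP => /dvdpP[R eR].
have R0 : R != 0.
  by apply: contraTneq mi => R0; rewrite eR R0 mul0r monicE lead_coef0 eq_sym oner_eq0.
have sR : (size R <= (size (ps i)).-1)%N by rewrite eR size_mulX.
pose w : 'rV_((size (ps i)).-1) := poly_rV R.
have w0 : w *m companionmx (ps i) = 0.
  apply: (can_inj rVpolyK).
  by rewrite rVpoly_companion // poly_rV_K // mulrC -eR modpp linear0.
(* The kernel vector w of the i-th block, padded with zeros. *)
pose z : 'cV_(\sum_i (size (ps i)).-1) :=
  \mxcol_j (if j =P i is ReflectT e then
    castmx (congr1 (fun j => (size (ps j)).-1) (esym e), erefl) w^T else 0).
have : \mxdiag_i companion (ps i) *m z = 0.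
  rewrite mul_mxdiag_mxcol; apply/mxcolP => j; rewrite mxcolK submxcol0.
  case: eqP => [ej | _]; last by rewrite mulmx0.
  by case: _ / (esym ej); rewrite castmx_id -trmx_mul w0 trmx0.
move/(congr1 (mulmx (invmx (\mxdiag_i companion (ps i))))).
rewrite mulKmx // mulmx0 => /(congr1 (fun z => submxcol z i)).
rewrite mxcolK submxcol0; case: eqP => // e0; rewrite eq_axiomK castmx_id => wT0.
have : rVpoly w = 0 by rewrite -[w]trmxK wT0 trmx0 linear0.
by rewrite poly_rV_K // => R1; rewrite R1 eqxx in R0.
Qed.

Lemma zero_cycleP u : M \in unitmx ->
  returns_some (zero_cycle M u) (period (fun n => iter n (affine_step M u) 0 = 0)).
Proof.
move=> uM; apply: returns_some_call => [||C specC]; first exact: period_unique.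
  exact: rcf_exists.
apply: returns_some_weaken.
  apply: (returns_some_lcmM (Q := fun i n =>
    rcf_poly C i %| geometric n * rVpoly (rcf_block u i)^T)) => i _.
  apply: zero_cycle_companionP; last exact: rcf_poly_coprimeX.
  by case: specC => /(_ i)[].
move=> a; apply: eq_period => n.
have coP i := rcf_poly_coprimeX i specC uM.
case: C specC coP => k ps e T [/= mon _ uT eM] _.
transitivity (iter n (affine_step (invmx T *m M *m T) (invmx T *m u)) 0 = 0); last first.
  rewrite iter_affine_conj //; split=> [/(congr1 (mulmx T)) | ->]; last by rewrite mulmx0.
  by rewrite mulKVmx // mulmx0.
rewrite eM /rcf_block /=; move: (invmx T *m u) => w.
pose w' := castmx (esym e, erefl 1%N) w.
transitivity (iter n (affine_step (\mxdiag_i companion (ps i)) w') 0 = 0); last first.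
  rewrite {}/w'.
  by case: _ / e w {T uT eM} => w; rewrite !castmx_id.
rewrite -/w'; clearbody w'; move: w' => {}w; split=> [Pi | it0 i _]; last first.
  rewrite -iter_affine_companion; last by case: (mon i).
  by rewrite -(iter_affine_mxdiag (fun i => companion (ps i))) it0 submxcol0.
apply/mxcolP => i; rewrite submxcol0 iter_affine_mxdiag; apply/eqP.
rewrite iter_affine_companion; last by case: (mon i).
by apply: Pi; rewrite mem_enum.
Qed.
End ZeroCycle.

End LinearAlgebra.

(** * Polycyclic generating sequences and their arithmetic *)

Section GroupTheory.
Import GroupScope GRing.Theory.

Section PcgsTheory.
Variable gT : finGroupType.
Implicit Types (G H K : {group gT}) (g s : seq gT) (x h u : gT) (e v : seq nat).

Lemma tail_group_cons x s i : tail_group (x :: s) i.+1 = tail_group s i.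
Proof. by []. Qed.

Lemma relative_order_cons x s i : relative_order (x :: s) i.+1 = relative_order s i.
Proof. by []. Qed.

Lemma tail_group_drop g a i : tail_group (drop a g) i = tail_group g (i + a).
Proof. by rewrite /tail_group drop_drop. Qed.

Lemma tail_group_oversize g i : size g <= i -> tail_group g i = 1%G.
Proof.
move=> le; apply: val_inj; rewrite /= drop_oversize //.
by rewrite (_ : [set x in [::]] = set0) ?gen0 //; apply/setP=> x; rewrite !inE.
Qed.

(** What one generator contributes: G is the disjoint union of the cosets x^a K
    with a below the prime order of G / K. *)
Record pcgs_step G x K : Prop := PcgsStep {
  step_mem : x \in G;
  step_normal : K <| G;
  step_notin : x \notin K;
  step_prime : prime #|G / K|;
  step_cover : forall h, h \in G -> exists2 a, a < #|G / K| & x ^- a * h \in K;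
  step_inj : forall a b h, a < #|G / K| -> b < #|G / K| -> x ^- a * h \in K ->
             x ^- b * h \in K -> a = b }.

Lemma pcgs_stepI G x K : x \in G -> K <| G -> x \notin K -> prime #|G / K| ->
  pcgs_step G x K.
Proof.
move=> xG nKG xK pr; have /andP[sKG nK] := nKG.
have xN := subsetP nK x xG.
have ntx : coset K x != 1 by apply: contra xK => /eqP/(coset_idr xN).
have gen : G / K = <[coset K x]>.
  by apply: nt_gen_prime => //; rewrite 2!inE ntx mem_quotient.
have ox : #[coset K x] = #|G / K| by rewrite gen.
have cosK a h : h \in G -> (x ^- a * h \in K) = (coset K x ^+ a == coset K h).
  move=> hG; have hN := subsetP nK h hG.
  rewrite -morphX // [RHS]eq_mulVg1; apply/idP/eqP => [hK | e1].
    by rewrite -morphV ?groupX // -morphM ?groupV ?groupX //= coset_id.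
  apply: coset_idr; first by rewrite groupM ?groupV ?groupX.
  by rewrite morphM ?groupV ?groupX // morphV ?groupX.
split=> // [h hG | a b h lta ltb ha hb].
  have : coset K h \in <[coset K x]> by rewrite -gen mem_quotient.
  by case/cyclePmin => a; rewrite ox => lta eh; exists a => //; rewrite cosK // eh.
have hG : h \in G.
  by rewrite -(mulKVg (x ^+ a) h) groupM ?groupX // (subsetP sKG).
rewrite !cosK // in ha hb; move: ha; rewrite -(eqP hb) eq_expg_mod_order ox.
by rewrite !modn_small // => /eqP.
Qed.

Lemma pcgs_cons G x s : pcgs G (x :: s) ->
  pcgs_step G x (tail_group s 0) /\ pcgs (tail_group s 0) s.
Proof.
move=> [eG st]; have [] := st 0 isT; rewrite /relative_order tail_group_cons eG => nK pr.
split; last by split=> // i lti; apply: (st i.+1 lti).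
have xG : x \in G by rewrite -eG /= mem_gen // !inE eqxx.
apply: pcgs_stepI => //; apply/negP => xK.
have sGK : G \subset tail_group s 0.
  rewrite -eG gen_subG; apply/subsetP => y; rewrite !inE => /predU1P[-> // | ys].
  by rewrite mem_gen // inE drop0.
have : #|G / tail_group s 0| = 1%N.
  by apply/eqP; rewrite -trivg_card1 -subG1 quotient_sub1 ?normal_norm.
by move=> e1; rewrite e1 in pr.
Qed.

(** Exponent vectors are found by dividing off the leading generator, which makes
    induction on the generating sequence possible. *)
Lemma expvec_cons x s h a v : expvec (x :: s) h (a :: v) <->
  a < relative_order (x :: s) 0 /\ expvec s (x ^- a * h) v.
Proof.
split=> [[/= [sz] lt ->] | [lta [sz lt eh]]].
  split; first exact: (lt 0).
  by split=> // [i /(lt i.+1) //|]; rewrite big_ord_recl /= mulKg.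
split=> [|[|i] //= lti|]; rewrite /= ?sz //; first exact: lt.
by rewrite big_ord_recl /= -eh mulKVg.
Qed.

Lemma expvec_nil h : expvec [::] h [::] <-> h = 1.
Proof. by split=> [[_ _ ->] | ->]; last split=> //; rewrite big_ord0. Qed.

Lemma expvec_mem g h e : expvec g h e -> h \in tail_group g 0.
Proof.
case=> _ _ ->; apply: group_prod => i _; rewrite groupX // mem_gen // inE drop0.
exact: mem_nth.
Qed.

Lemma pcgs_gen_mem G g y : pcgs G g -> y \in g -> y \in G.
Proof. by case=> <- _ yg; rewrite mem_gen // inE drop0. Qed.

Lemma gen_in_tail g a i : a <= i -> nth 1 g i \in tail_group g a.
Proof.
move=> leai; have [lti | gei] := ltnP i (size g); last by rewrite nth_default // group1.
rewrite mem_gen // inE -{1}(subnKC leai) -nth_drop mem_nth // size_drop.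
by rewrite ltn_sub2r // (leq_ltn_trans leai).
Qed.

Lemma pcgs_mem G g h e : pcgs G g -> expvec g h e -> h \in G.
Proof. by case=> <- _ /expvec_mem. Qed.

Lemma expvec_exists G g h : pcgs G g -> h \in G -> exists e, expvec g h e.
Proof.
elim: g G h => [|x s IH] G h pG hG.
  case: pG => eG _; exists [::]; apply/expvec_nil/set1gP.
  by move: hG; rewrite -eG tail_group_oversize.
have [st ps] := pcgs_cons pG; have [a lta ha] := step_cover st hG.
have [v hv] := IH _ _ ps ha.
exists (a :: v); apply/expvec_cons; split=> //.
by case: pG => eG _; rewrite /relative_order eG.
Qed.

Lemma relative_order0 G x s : pcgs G (x :: s) ->
  relative_order (x :: s) 0 = #|G / tail_group s 0|.
Proof. by case=> eG _; rewrite /relative_order eG. Qed.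

(** Two leading exponents below the relative order that lead into the same tail
    group coincide. *)
Lemma expvec_unique G g h e e' : pcgs G g -> expvec g h e -> expvec g h e' -> e = e'.
Proof.
elim: g G h e e' => [|x s IH] G h e e' pG.
  by case=> /size0nil-> _ _ [/size0nil-> _ _].
case: e => [[] //|a v]; case: e' => [_ [] //|b w] /expvec_cons[lta ha] /expvec_cons[ltb hb].
have [st ps] := pcgs_cons pG; rewrite (relative_order0 pG) in lta ltb.
have eab : a = b by apply: (step_inj st lta ltb (pcgs_mem ps ha) (pcgs_mem ps hb)).
by rewrite -eab in hb *; rewrite (IH _ _ _ _ ps ha hb).
Qed.

Lemma tail_group_exponents G g h e c : pcgs G g -> expvec g h e ->
  h \in tail_group g c <-> (forall i, i < c -> nth 0%N e i = 0%N).
Proof.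
elim: g G h e c => [|x s IH] G h e c pG he.
  have e1 : e = [::] by case: he => /size0nil.
  move: he; rewrite e1 => /expvec_nil->; split=> [_ i _ | _]; first by rewrite nth_nil.
  exact: group1.
case: e he => [[] //|a v] /expvec_cons[lta ha].
have [st ps] := pcgs_cons pG; rewrite (relative_order0 pG) in lta.
case: c => [|c]; first split=> // _.
  by case: pG => -> _; rewrite -(mulKVg (x ^+ a) h) groupM ?groupX ?(step_mem st) //;
  apply: (subsetP (normal_sub (step_normal st))); apply: pcgs_mem ha.
rewrite tail_group_cons; split=> [hc | allz].
  have hK : h \in tail_group s 0.
    by apply: subsetP hc; apply: genS; apply/subsetP => y; rewrite !inE drop0 => /mem_drop.
  have a0 : a = 0%N.
    apply: (step_inj st lta _ (pcgs_mem ps ha)); first exact: prime_gt0 (step_prime st).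
    by rewrite expg0 invg1 mul1g.
  rewrite a0 expg0 invg1 mul1g in ha.
  by case=> [_ | i /(iffLR (IH _ _ _ _ ps ha) hc) //]; rewrite a0.
have a0 : a = 0%N := allz 0 isT.
rewrite a0 expg0 invg1 mul1g in ha.
by apply/(IH _ _ _ _ ps ha) => i; apply: (allz i.+1).
Qed.

Lemma expvec_size g h e : expvec g h e -> size e = size g. Proof. by case. Qed.

Lemma expvec_one G g : pcgs G g -> expvec g 1 (nseq (size g) 0%N).
Proof.
move=> [_ pr]; split; first by rewrite size_nseq.
  by move=> i lti; rewrite nth_nseq lti prime_gt0 //; case: (pr i lti).
by rewrite big1 // => i _; rewrite nth_nseq ltn_ord.
Qed.

Definition unit_exponents n i := [seq nat_of_bool (i == j) | j <- iota 0 n].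

Lemma nth_unit_exponents n i j : j < n -> nth 0%N (unit_exponents n i) j = (i == j) :> nat.
Proof. by move=> ltj; rewrite (nth_map 0%N) ?size_iota // nth_iota // add0n. Qed.

Lemma expvec_gen G g i : pcgs G g -> i < size g ->
  expvec g (nth 1 g i) (unit_exponents (size g) i).
Proof.
move=> pG lti; split=> [|j ltj|]; first by rewrite size_map size_iota.
  rewrite nth_unit_exponents //.
  have /prime_gt1 := proj2 (proj2 pG j ltj); case: (i == j) => // /ltnW //.
rewrite (eq_bigr (fun j : 'I_(size g) => if j == Ordinal lti then nth 1 g i else 1)).
  rewrite -big_mkcond /=.
  by rewrite (big_pred1_id _ _ (i := Ordinal lti)) //= mulg1.
move=> j _; rewrite nth_unit_exponents //.
by rewrite -val_eqE /= eq_sym; case: eqP => [-> | _]; rewrite ?expg1 ?expg0.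
Qed.

Lemma presentation_cons x s R1 R : presentation_of (x :: s) (R1 :: R) ->
  [/\ rel_order R1 = relative_order (x :: s) 0,
      expvec s (x ^+ rel_order R1) (rel_power R1),
      expvecs s [seq y ^ x | y <- s] (rel_conj R1)
    & presentation_of s R].
Proof.
move=> [[szR] pres]; have /= := pres 0 isT; rewrite drop0 => -[oR pR cR].
by split=> //; split=> // i lti; apply: (pres i.+1).
Qed.

Section VecEval.
Variables (s : seq gT) (mul : seq nat -> seq nat -> seq nat) (one : seq nat).
Hypothesis oneP : expvec s 1 one.
Hypothesis mulP : forall h u v w, expvec s h v -> expvec s u w -> expvec s (h * u) (mul v w).

Lemma vec_powP h v k : expvec s h v -> expvec s (h ^+ k) (vec_pow mul one v k).
Proof. by move=> hv; elim: k => [|k IH] //=; rewrite expgS; apply: mulP. Qed.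

(** Evaluating an exponent vector at the exponent vectors of given elements
    computes the corresponding product; it is stated relative to any correct
    multiplication because it is used inside the recursion defining [pc_mul]. *)
Lemma vec_evalP (ys : seq gT) vs e : expvecs s ys vs -> size e = size ys ->
  expvec s (\prod_(i < size ys) nth 1 ys i ^+ nth 0%N e i) (vec_eval mul one vs e).
Proof.
elim: ys vs e => [|y ys IH] [|v vs] [|a e] //= [] // ; first by rewrite big_ord0.
move=> [szv] vsP [sze]; rewrite big_ord_recl /vec_eval /=; apply: mulP.
  exact: vec_powP (vsP 0 isT).
by apply: IH => //; split=> // i lti; apply: (vsP i.+1).
Qed.
End VecEval.

(** Collection: (x^a u)(x^b v) = x^(a+b) u^(x^b) v, where conjugation by x is read
    off the conjugation relations and an excess power x^p off the power
    relation. *)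
Lemma pc_mulP G g R h u v w : pcgs G g -> presentation_of g R ->
  expvec g h v -> expvec g u w -> expvec g (h * u) (pc_mul R v w).
Proof.
elim: g R G h u v w => [|x s IH] [|R1 R] G h u v w pG; try by case.
  move=> _ hv uw; have := expvec_size hv; have := expvec_size uw.
  move=> /size0nil ew /size0nil ev; move: hv uw; rewrite ew ev.
  by move=> /expvec_nil-> /expvec_nil->; rewrite mul1g; apply/expvec_nil.
move=> /presentation_cons[oR pR cR pres].
case: v => [[] //|a v]; case: w => [_ [] //|b w] /expvec_cons[lta hv] /expvec_cons[ltb uw].
have [st ps] := pcgs_cons pG.
have mulP h1 u1 v1 w1 := IH R (tail_group s 0) h1 u1 v1 w1 ps pres.
have szR : size R = size s by case: pres.
have oneP : expvec s 1 (nseq (size R) 0%N) by rewrite szR; apply: expvec_one ps.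
rewrite /=; set mul := pc_mul R; set conj := vec_eval _ _ _.
have conjP z t : expvec s z t -> expvec s (z ^ x) (conj t).
  move=> zt; have := vec_evalP oneP mulP cR; rewrite size_map => /(_ t).
  case: (zt) => sz _ ez /(_ sz); congr expvec; rewrite [in RHS]ez.
  rewrite (big_morph (conjg^~ x) (fun y1 y2 => conjMg y1 y2 x) (conj1g x)).
  by apply: eq_bigr => i _; rewrite conjXg (nth_map 1).
have iterP z t k : expvec s z t -> expvec s (z ^ (x ^+ k)) (iter k conj t).
  move=> zt; elim: k => [|k IHk]; first by rewrite conjg1.
  by rewrite expgSr conjgM; apply: conjP.
set h1 := x ^- a * h in hv; set u1 := x ^- b * u in uw.
have uP := mulP _ _ _ _ (iterP _ _ b hv) uw.
have e1 : h * u = x ^+ (a + b) * (h1 ^ (x ^+ b) * u1).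
  by rewrite /h1 /u1 conjgE expgD -!mulgA !mulKVg.
rewrite e1 oR; case: ifP => [ltab | geab]; apply/expvec_cons; split=> //.
- by rewrite mulKg.
- have /negbT := geab; rewrite -leqNgt => {}geab.
  by rewrite -(ltn_add2r (relative_order (x :: s) 0)) subnK // -addSn leq_add // ltnW.
rewrite oR in pR.
have /negbT := geab; rewrite -leqNgt => {}geab.
have -> : x ^- (a + b - relative_order (x :: s) 0) *
    (x ^+ (a + b) * (h1 ^ (x ^+ b) * u1)) =
    x ^+ relative_order (x :: s) 0 * (h1 ^ (x ^+ b) * u1).
  by rewrite -{2}(subnK geab) expgD -mulgA mulKg.
exact: mulP.
Qed.

Section Arithmetic.
Variables (G : {group gT}) (g : seq gT) (R : seq pcrel).
Hypotheses (pG : pcgs G g) (pres : presentation_of g R).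

Lemma pc_oneP : expvec g 1 (pc_one R).
Proof. by rewrite /pc_one; case: pres => -> _; apply: expvec_one pG. Qed.

Let mulP h u v w := @pc_mulP G g R h u v w pG pres.

Lemma rel_order_prod : (\prod_(y <- R) rel_order y)%N = #|G|.
Proof.
elim: g G R pG pres => [|x s IH] G' [|R1 R'] pG' pres'; try by case: pres'.
  case: pG' => <- _; rewrite big_nil tail_group_oversize //= cards1 //.
have [oR _ _ pR] := presentation_cons pres'; have [st ps] := pcgs_cons pG'.
rewrite big_cons oR (relative_order0 pG') (IH _ _ ps pR).
have nK := step_normal st.
by rewrite card_quotient ?normal_norm // mulnC Lagrange ?normal_sub.
Qed.

Lemma pc_invP h v : expvec g h v -> expvec g h^-1 (pc_inv R v).
Proof.
move=> hv; have hG := pcgs_mem pG hv; rewrite /pc_inv rel_order_prod.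
have -> : h^-1 = h ^+ #|G|.-1.
  by apply: (mulgI h); rewrite mulgV -expgS prednK ?cardG_gt0 // expg_cardG.
exact: vec_powP pc_oneP mulP _ _ _ hv.
Qed.

Section Automorphism.
Variable (alpha : {perm gT}).
Hypothesis autA : alpha \in Aut G.

Lemma aut_mulP y z : y \in G -> z \in G -> alpha (y * z) = alpha y * alpha z.
Proof. by move=> yG zG; have := morphM (autm_morphism autA) yG zG. Qed.

Lemma aut_mem y : y \in G -> alpha y \in G.
Proof. by move=> yG; rewrite (Aut_closed autA). Qed.

Lemma aut_one : alpha 1 = 1.
Proof. by apply: (mulgI (alpha 1)); rewrite -aut_mulP // !mulg1. Qed.

Lemma aut_exp y k : y \in G -> alpha (y ^+ k) = alpha y ^+ k.
Proof.
move=> yG; elim: k => [|k IH]; first exact: aut_one.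
by rewrite !expgS aut_mulP ?groupX // IH.
Qed.

Lemma aut_inv y : y \in G -> alpha y^-1 = (alpha y)^-1.
Proof.
by move=> yG; apply: (mulgI (alpha y)); rewrite -aut_mulP ?groupV // !mulgV aut_one.
Qed.

(** An automorphism maps a product of powers of generators to the product of the
    powers of their images. *)
Lemma pc_appP A h v : expmatrix g alpha A -> expvec g h v ->
  expvec g (alpha h) (pc_app R A v).
Proof.
move=> mA hv; have := vec_evalP pc_oneP mulP mA; rewrite size_map => /(_ v).
case: (hv) => sz _ eh /(_ sz); congr expvec; rewrite [in RHS]eh.
have gG i : i < size g -> nth 1 g i \in G.
  by move=> lti; case: pG => <- _; rewrite mem_gen // inE drop0 mem_nth.
suff [_ ->] : \prod_(i < size g) nth 1 g i ^+ nth 0%N v i \in G /\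
  alpha (\prod_(i < size g) nth 1 g i ^+ nth 0%N v i) =
  \prod_(i < size g) alpha (nth 1 g i ^+ nth 0%N v i).
  by apply: eq_bigr => i _; rewrite aut_exp ?gG // (nth_map 1).
elim/big_rec2: _ => [|i y z _ [zG ez]]; first by rewrite aut_one.
split; first by rewrite groupM ?groupX ?gG.
by rewrite aut_mulP ?groupX ?gG // ez.
Qed.
End Automorphism.

Lemma expmatrix_unit : expmatrix g 1 (pc_id R).
Proof.
case: pres => szR _; split; first by rewrite !size_map size_iota.
move=> i; rewrite size_map => lti; rewrite (nth_map 1) // perm1.
rewrite /pc_id (nth_map 0%N) ?size_iota ?szR // nth_iota // add0n.
exact: expvec_gen pG lti.
Qed.

Lemma pc_compP alpha beta A B : alpha \in Aut G -> beta \in Aut G ->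
  expmatrix g alpha A -> expmatrix g beta B ->
  expmatrix g (beta * alpha) (pc_comp R A B).
Proof.
move=> autA autB mA [szB mB]; rewrite size_map in szB mB.
split; rewrite ?size_map // => i lti.
rewrite (nth_map 1) // permM (nth_map [::]) ?szB //.
by have := mB i lti; rewrite (nth_map 1) // => /(pc_appP autA mA).
Qed.

Lemma pc_aut_powP alpha A k : alpha \in Aut G -> expmatrix g alpha A ->
  expmatrix g (alpha ^+ k) (pc_aut_pow R A k).
Proof.
move=> autA mA; elim: k => [|k IH]; first exact: expmatrix_unit.
by rewrite expgSr; apply: pc_compP => //; rewrite groupX.
Qed.

Definition affine_data (ta : gT * {perm gT}) (x : seq nat * seq (seq nat)) : Prop :=
  [/\ ta.1 \in G, ta.2 \in Aut G, expvec g ta.1 x.1 & expmatrix g ta.2 x.2].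

Lemma pc_aff_powP t alpha (x : seq nat * seq (seq nat)) k : affine_data (t, alpha) x ->
  exists2 t', affine_data (t', alpha ^+ k) (pc_aff_pow R x k) &
   {in G, forall y, iter k (affine_map t alpha) y = affine_map t' (alpha ^+ k) y}.
Proof.
move=> [/= tG autA tx mA]; elim: k => [|k [t' [/= tG' autA' tx' mA'] IH]].
  exists 1; last by move=> y _; rewrite /affine_map mul1g perm1.
  by split; [exact: group1 | exact: group1 | exact: pc_oneP | exact: expmatrix_unit].
exists (t * alpha t').
  split=> /=; rewrite ?groupM ?groupX ?(aut_mem autA) //.
    by apply: mulP => //; apply: pc_appP.
  by rewrite expgSr; apply: pc_compP.
move=> y yG /=; rewrite IH // /affine_map aut_mulP ?(aut_mem autA') //.
by rewrite mulgA expgSr permM.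
Qed.

Lemma expmatrix_unique alpha beta A : alpha \in Aut G -> beta \in Aut G ->
  expmatrix g alpha A -> expmatrix g beta A -> alpha = beta.
Proof.
move=> autA autB mA mB; apply/permP => y; have [yG | nyG] := boolP (y \in G); last first.
  by rewrite !(out_Aut _ nyG).
have [v yv] := expvec_exists pG yG.
have [_ _ ->] := pc_appP autA mA yv.
by have [_ _ ->] := pc_appP autB mB yv.
Qed.

Lemma expvecs_unique (ys : seq gT) es es' : expvecs g ys es -> expvecs g ys es' -> es = es'.
Proof.
move=> [sz1 e1] [sz2 e2]; apply: (@eq_from_nth _ [::]); first by rewrite sz1.
by move=> i; rewrite sz1 => lti; apply: expvec_unique pG (e1 i lti) (e2 i lti).
Qed.

(** The right side mentions neither the group nor the automorphism, so the order
    of an automorphism depends on R and A only. *)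
Lemma aut_pow_eq1 alpha A n : alpha \in Aut G -> expmatrix g alpha A ->
  alpha ^+ n = 1 <-> pc_aut_pow R A n = pc_id R.
Proof.
move=> autA mA; have mP := pc_aut_powP n autA mA; split=> [e1 | eP].
  by rewrite e1 in mP; apply: expvecs_unique mP _; apply: expmatrix_unit.
rewrite eP in mP; apply: expmatrix_unique mP expmatrix_unit; first exact: groupX.
exact: group1.
Qed.

Lemma iter_affineP alpha A t tv y v n : alpha \in Aut G -> expmatrix g alpha A ->
  expvec g t tv -> expvec g y v ->
  expvec g (iter n (affine_map t alpha) y)
           (iter n (fun w => pc_mul R tv (pc_app R A w)) v).
Proof.
move=> autA mA ht hy; elim: n => [|n IH] //=.
by apply: mulP => //; apply: pc_appP.
Qed.

(** As for the order of an automorphism, the right side depends only on exponent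
    vectors, so cycle lengths do not depend on the group presented by R. *)
Lemma affine_cycle_eq alpha A t tv y v n : alpha \in Aut G -> expmatrix g alpha A ->
  expvec g t tv -> expvec g y v ->
  iter n (affine_map t alpha) y = y <->
  iter n (fun w => pc_mul R tv (pc_app R A w)) v = v.
Proof.
move=> autA mA ht hy; have hn := iter_affineP n autA mA ht hy.
split=> [e1 | e1]; first by rewrite e1 in hn; apply: expvec_unique pG hn hy.
by rewrite e1 in hn; case: hn => _ _ ->; case: hy.
Qed.
End Arithmetic.
End PcgsTheory.

(** * Coordinates on elementary abelian sections *)

Section Exponents.
Variable gT : finGroupType.
Implicit Types (G H K A B : {group gT}) (g s : seq gT) (x h u : gT) (e v : seq nat).

(** Searching for the leading exponent makes exponent vectors a total function of
    the element, from which coordinate maps can be built. *)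
Fixpoint exponents g h : seq nat :=
  if g is x :: s then
    let a := find (fun a => x ^- a * h \in tail_group s 0)
                  (iota 0 (relative_order g 0)) in
    a :: exponents s (x ^- a * h)
  else [::].

Lemma exponentsP G g h : pcgs G g -> h \in G -> expvec g h (exponents g h).
Proof.
elim: g G h => [|x s IH] G h pG hG.
  by case: pG => eG _; apply/expvec_nil/set1gP; rewrite -eG tail_group_oversize in hG.
have [st ps] := pcgs_cons pG; have [a lta ha] := step_cover st hG.
rewrite /=; set P := (fun _ => _); set r := iota _ _.
have hasP : has P r.
  by apply/hasP; exists a; rewrite // mem_iota add0n (relative_order0 pG).
have ltf : find P r < relative_order (x :: s) 0 by move: hasP; rewrite has_find size_iota.
have := nth_find 0%N hasP; rewrite /r nth_iota // add0n -/r => fK.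
by apply/expvec_cons; split=> //; apply: IH ps fK.
Qed.

Lemma exponentsE G g h e : pcgs G g -> expvec g h e -> exponents g h = e.
Proof.
by move=> pG he; apply: expvec_unique pG (exponentsP pG (pcgs_mem pG he)) he.
Qed.

Lemma tail_groupS g a b : a <= b -> tail_group g b \subset tail_group g a.
Proof.
move=> leab; apply: genS; apply/subsetP => x; rewrite !inE.
by rewrite -(subnK leab) -drop_drop => /mem_drop.
Qed.

Lemma pcgs_drop G g a : pcgs G g -> pcgs (tail_group g a) (drop a g).
Proof.
move=> [_ pr]; split; first by rewrite tail_group_drop.
move=> i; rewrite size_drop ltn_subRL addnC => lti.
by have := pr _ lti; rewrite /relative_order !tail_group_drop.
Qed.

Lemma expvec_drop G g a h e : pcgs G g -> h \in tail_group g a -> expvec g h e ->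
  expvec (drop a g) h (drop a e).
Proof.
elim: a g G h e => [|a IH] g G h e pG ha; first by rewrite !drop0.
case: g pG ha => [|x s] pG ha he; first by case: (he) => /size0nil->.
have := iffLR (tail_group_exponents a.+1 pG he) ha.
case: e he => [[] //|c v] he allz; have c0 : c = 0%N := allz 0 isT.
move: he; rewrite c0 => /expvec_cons[_]; rewrite expg0 invg1 mul1g => hv.
by have [_ ps] := pcgs_cons pG; apply: IH ps ha hv.
Qed.

(** On a section A / B that is abelian of exponent p, reordering a product costs a
    commutator and reducing an exponent costs a p-th power; both lie in B, which
    does not show in the first l exponents. *)
Lemma exponents_mul A B s l p : pcgs A s -> l <= size s -> tail_group s l = B -> prime p ->
  (forall i, i < l -> relative_order s i = p) ->
  {in A &, forall h u, [~ h, u] \in B} -> {in A, forall h, h ^+ p \in B} ->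
  {in A &, forall h u i, i < l -> nth 0%N (exponents s (h * u)) i =
     (nth 0%N (exponents s h) i + nth 0%N (exponents s u) i) %% p}.
Proof.
move=> + + + pr_p; elim: l s A => [|l IH] [|x s] A // pA lel eB ord comB expB h u hA uA i lti.
have [st ps] := pcgs_cons pA; set K := tail_group s 0 in st ps.
have sKA : K \subset A by exact: normal_sub (step_normal st).
have BK : B \subset K by rewrite -eB tail_group_cons tail_groupS.
have subK : {subset K <= A} by apply/subsetP.
have {}IH : {in K &, forall y z j, j < l -> nth 0%N (exponents s (y * z)) j =
     (nth 0%N (exponents s y) j + nth 0%N (exponents s z) j) %% p}.
  apply: IH => //; first by move=> j; apply: (ord j.+1).
    by move=> y z /subK yA /subK zA; apply: comB.
  by move=> y /subK; apply: expB.
have zeroB z j : z \in B -> j < l -> nth 0%N (exponents s z) j = 0%N.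
  move=> zB; have zK : z \in K by apply: (subsetP BK).
  apply: (iffLR (tail_group_exponents l ps (exponentsP ps zK)) _ j) => //.
  by rewrite -(tail_group_cons x) eB.
have mulBl y z j : y \in B -> z \in K -> j < l ->
    nth 0%N (exponents s (y * z)) j = nth 0%N (exponents s z) j.
  move=> yB zK ltj; have yK := subsetP BK y yB; rewrite IH // zeroB // add0n modn_small //.
  have [_ ltz _] := exponentsP ps zK; rewrite -(ord j.+1) // relative_order_cons.
  by apply: ltz; apply: leq_trans ltj _.
have op : relative_order (x :: s) 0 = p := ord 0 isT.
have [a [h1 [lta h1K eh eE]]] : exists a h1, [/\ a < p, h1 \in K, h = x ^+ a * h1
    & exponents (x :: s) h = a :: exponents s h1].
  have := exponentsP pA hA; case eE: (exponents _ h) => [|a v]; first by case.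
  move=> /expvec_cons[lta hv]; exists a, (x ^- a * h).
  by rewrite -op mulKVg (exponentsE ps hv) (pcgs_mem ps hv).
have [b [u1 [ltb u1K eu uE]]] : exists b u1, [/\ b < p, u1 \in K, u = x ^+ b * u1
    & exponents (x :: s) u = b :: exponents s u1].
  have := exponentsP pA uA; case eE': (exponents _ u) => [|b v]; first by case.
  move=> /expvec_cons[ltb hv]; exists b, (x ^- b * u).
  by rewrite -op mulKVg (exponentsE ps hv) (pcgs_mem ps hv).
have cB : [~ h1, x ^+ b] \in B
  by apply: comB; [exact: subK | rewrite groupX //; exact: step_mem st].
have cK := subsetP BK _ cB.
have cuK : [~ h1, x ^+ b] * u1 \in K by apply: groupM.
have hcuK : h1 * ([~ h1, x ^+ b] * u1) \in K by apply: groupM.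
have ehu : h * u = x ^+ (a + b) * (h1 * ([~ h1, x ^+ b] * u1)).
  by rewrite eh eu expgD commgEl conjgE -!mulgA !mulKVg.
have [ltab | geab] := ltnP (a + b) p.
  have -> : exponents (x :: s) (h * u) = (a + b)%N :: exponents s (h1 * ([~ h1, x ^+ b] * u1)).
    apply: exponentsE pA _; apply/expvec_cons; rewrite op; split=> //.
    by rewrite ehu mulKg; apply: exponentsP ps _.
  rewrite eE uE; case: i lti => [|i] lti /=; first by rewrite modn_small.
  by rewrite IH // mulBl.
have xpB : x ^+ p \in B by apply: expB; exact: step_mem st.
have xpK := subsetP BK _ xpB.
have -> : exponents (x :: s) (h * u) =
    (a + b - p)%N :: exponents s (x ^+ p * (h1 * ([~ h1, x ^+ b] * u1))).
  apply: exponentsE pA _; apply/expvec_cons; rewrite op; split.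
    by rewrite -(ltn_add2r p) subnK // -addSn leq_add // ltnW.
  rewrite ehu -{2}(subnK geab) expgD -mulgA mulKg.
  by apply: exponentsP ps _; apply: groupM.
rewrite eE uE; case: i lti => [|i] lti /=.
  rewrite -{2}(subnK geab) modnDr modn_small //.
  by rewrite -(ltn_add2r p) subnK // -addSn leq_add // ltnW.
by rewrite mulBl // IH // mulBl.
Qed.

End Exponents.

Section Layer.
Variables (gT : finGroupType) (G : {group gT}) (g : seq gT) (a l p : nat).
Let A := tail_group g a.
Let B := tail_group g (a + l).
Hypotheses (pG : pcgs G g) (leg : a + l <= size g) (pr_p : prime p).
Hypothesis ord : forall i, i < l -> relative_order g (a + i) = p.
Hypothesis comB : {in A &, forall h u, [~ h, u] \in B}.
Hypothesis expB : {in A, forall h, h ^+ p \in B}.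

Local Open Scope ring_scope.

Definition layer_coords (e : seq nat) : 'cV['F_p]_l := \col_j (nth 0%N e (a + j))%:R.

Definition coords h := layer_coords (exponents g h).

Lemma coordsE h e : expvec g h e -> coords h = layer_coords e.
Proof. by move=> he; rewrite /coords (exponentsE pG he). Qed.

Let AG : A \subset G.
Proof. by case: pG => <- _; apply: tail_groupS. Qed.

Lemma coordsM h u : h \in A -> u \in A -> coords (h * u)%g = coords h + coords u.
Proof.
move=> hA uA; have hG := subsetP AG h hA; have uG := subsetP AG u uA.
have pA := pcgs_drop a pG.
have nthE z (j : 'I_l) : z \in A ->
    nth 0%N (exponents g z) (a + j) = nth 0%N (exponents (drop a g) z) j.
  move=> zA; have zG := subsetP AG z zA.
  by rewrite (exponentsE pA (expvec_drop pG zA (exponentsP pG zG))) nth_drop.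
apply/colP => j; rewrite !mxE !nthE ?groupM //.
rewrite (@exponents_mul _ A B _ l p) // ?Fp_nat_mod ?natrD //.
- by rewrite size_drop leq_subRL ?(leq_trans (leq_addr l a) leg).
- by rewrite tail_group_drop addnC.
- by move=> i lti; rewrite -(ord lti) /relative_order !tail_group_drop addSn (addnC i).
Qed.

Lemma coords_eq0 h : h \in A -> coords h = 0 <-> h \in B.
Proof.
move=> hA; have hG := subsetP AG h hA; have he := exponentsP pG hG.
have [sz lte _] := he.
split=> [c0 | /(iffLR (tail_group_exponents _ pG he)) z]; last first.
  by apply/colP => j; rewrite !mxE z ?ltn_add2l.
apply/(tail_group_exponents _ pG he) => i lti.
have [ltia | leai] := ltnP i a.
  by have /(iffLR (tail_group_exponents _ pG he)) := hA; apply.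
have ltj : (i - a < l)%N by rewrite ltn_subLR.
have /colP/(_ (Ordinal ltj)) := c0; rewrite !mxE /= subnKC //.
move/(congr1 (fun z : 'F_p => z : nat)); rewrite val_Fp_nat //= modn_small //.
rewrite -(ord ltj) subnKC //; apply: lte; exact: leq_trans lti leg.
Qed.

Lemma coords1 : coords 1%g = 0.
Proof. by apply/coords_eq0; apply: group1. Qed.

Lemma coordsX h k : h \in A -> coords (h ^+ k)%g = coords h *+ k.
Proof.
move=> hA; elim: k => [|k IH]; first exact: coords1.
by rewrite expgS coordsM ?groupX // IH mulrS.
Qed.

Lemma coords_prod n (y : 'I_n -> gT) : (forall i, y i \in A) ->
  coords (\prod_(i < n) y i)%g = \sum_(i < n) coords (y i).
Proof.
move=> yA; suff [] : (\prod_(i < n) y i)%g \in A /\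
  coords (\prod_(i < n) y i)%g = \sum_(i < n) coords (y i) by [].
elim/big_rec2: _ => [|i z w _ [wA ew]]; first by rewrite coords1.
by rewrite groupM // coordsM // ew.
Qed.

Lemma coords_gen (j : 'I_l) : coords (nth 1%g g (a + j)) = delta_mx j 0.
Proof.
have lt : (a + j < size g)%N by apply: leq_trans leg; rewrite ltn_add2l.
rewrite (coordsE (expvec_gen pG lt)); apply/colP => k; rewrite !mxE eqxx andbT.
have ltk : (a + k < size g)%N by apply: leq_trans leg; rewrite ltn_add2l.
by rewrite nth_unit_exponents // eqn_add2l -val_eqE /= eq_sym; case: eqP.
Qed.

Definition layer_lift (c : 'cV['F_p]_l) : gT :=
  (\prod_(j < l) nth 1%g g (a + j) ^+ (c j 0%R : 'F_p))%g.

Lemma layer_lift_mem c : layer_lift c \in A.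
Proof. by apply: group_prod => j _; rewrite groupX // gen_in_tail // leq_addr. Qed.

Lemma layer_liftK c : coords (layer_lift c) = c.
Proof.
rewrite coords_prod => [|j]; last by rewrite groupX // gen_in_tail // leq_addr.
apply/colP => k; rewrite summxE (bigD1 k) //= big1 => [|j nj].
  by rewrite addr0 coordsX ?gen_in_tail ?leq_addr // coords_gen mulmxnE mxE !eqxx natr_Zp.
rewrite coordsX ?gen_in_tail ?leq_addr // coords_gen mulmxnE mxE eq_sym (negPf nj).
by rewrite mul0rn.
Qed.

Lemma coords_eq h u : h \in A -> u \in A -> coords h = coords u <-> (h^-1 * u)%g \in B.
Proof.
move=> hA uA; rewrite -coords_eq0 ?groupM ?groupV //.
have e : coords u = coords h + coords (h^-1 * u)%g.
  by rewrite -coordsM ?groupM ?groupV // mulKVg.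
rewrite e; split=> [/eqP | ->]; last by rewrite addr0.
by rewrite -[X in X == _]addr0 (inj_eq (addrI _)) eq_sym => /eqP.
Qed.

Definition layer_mx (M : seq (seq nat)) : 'M['F_p]_l :=
  \matrix_(j, k) (entry M (a + k) (a + j))%:R.

Section Aut.
Variables (alpha : {perm gT}) (M : seq (seq nat)).
Hypotheses (autA : alpha \in Aut G) (mM : expmatrix g alpha M).
Hypotheses (stA : {in A, forall h, alpha h \in A}) (stB : {in B, forall h, alpha h \in B}).

(** The transposed index order in [entry] makes the images of the generators the
    columns. *)
Lemma col_layer_mx (k : 'I_l) :
  col k (layer_mx M) = coords (alpha (nth 1%g g (a + k))).
Proof.
have lt : (a + k < size g)%N by apply: leq_trans leg; rewrite ltn_add2l.
case: mM => szM /(_ (a + k)%N); rewrite size_map => /(_ lt).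
rewrite (nth_map 1%g) // => /coordsE->.
by apply/colP => j; rewrite !mxE.
Qed.

(** Modulo B, an element is the product of the generators of the layer raised to
    its coordinates, and B itself is stable. *)
Lemma layer_mxP h : h \in A -> coords (alpha h) = layer_mx M *m coords h.
Proof.
move=> hA; have hG := subsetP AG h hA.
pose u := layer_lift (coords h); have uA : u \in A := layer_lift_mem _.
have uhB : (u^-1 * h)%g \in B by apply/coords_eq => //; rewrite layer_liftK.
have uhA : (u^-1 * h)%g \in A by rewrite groupM ?groupV.
have sAG := subsetP AG.
have -> : coords (alpha h) = coords (alpha u).
  rewrite -{1}(mulKVg u h) (aut_mulP autA) ?sAG // coordsM ?stA //.
  by rewrite (iffRL (coords_eq0 (stA uhA))) ?addr0 //; apply: stB.
have alphaX y k : y \in A -> coords (alpha (y ^+ k)%g) = coords (alpha y) *+ k.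
  by move=> yA; rewrite (aut_exp autA) ?sAG // coordsX ?stA.
have [_ ->] : u \in A /\ coords (alpha u) =
    \sum_(j < l) coords (alpha (nth 1%g g (a + j))) *+ (coords h j 0%R : 'F_p).
  rewrite /u /layer_lift.
  elim/big_rec2: _ => [|j z w _ [wA ew]]; first by rewrite (aut_one autA) coords1 group1.
  have gA : nth 1%g g (a + j) \in A by rewrite gen_in_tail ?leq_addr.
  split; first by rewrite groupM // groupX.
  by rewrite (aut_mulP autA) ?sAG ?groupX // coordsM ?stA ?groupX // alphaX // ew.
apply/colP => i; rewrite summxE mxE; apply: eq_bigr => j _.
rewrite -col_layer_mx mulmxnE -mulr_natr natr_Zp !mxE.
by [].
Qed.
End Aut.

Lemma aut_tail_pow (alpha : {perm gT}) (C : {group gT}) k : {in C, forall h, alpha h \in C} ->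
  {in C, forall h, (alpha ^+ k)%g h \in C}.
Proof.
by move=> stC h hC; elim: k => [|k IH]; rewrite ?perm1 // expgSr permM stC.
Qed.

Lemma layer_mx_pow (alpha : {perm gT}) M k h : alpha \in Aut G -> expmatrix g alpha M ->
  {in A, forall h, alpha h \in A} -> {in B, forall h, alpha h \in B} -> h \in A ->
  coords ((alpha ^+ k)%g h) = layer_mx M ^+ k *m coords h.
Proof.
move=> autA mM stA stB hA; elim: k => [|k IH]; first by rewrite perm1 expr0 mul1mx.
rewrite expgSr permM (layer_mxP autA mM stA stB) ?(aut_tail_pow _ stA) //.
by rewrite IH mulmxA exprS.
Qed.

(** The coordinates of the generators of the layer are the unit vectors, so a
    power of the matrix is the identity only if it is so on these elements. *)
Lemma layer_mx_pow1 (alpha : {perm gT}) M k : alpha \in Aut G -> expmatrix g alpha M ->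
  {in A, forall h, alpha h \in A} -> {in B, forall h, alpha h \in B} ->
  layer_mx M ^+ k = 1 <-> {in A, forall h, (h^-1 * (alpha ^+ k)%g h)%g \in B}.
Proof.
move=> autA mM stA stB; split=> [M1 h hA | triv].
  apply/coords_eq; rewrite ?(aut_tail_pow _ stA) //.
  by rewrite (layer_mx_pow _ autA mM) // M1 mul1mx.
apply/matrixP => i j; have gA : nth 1%g g (a + j) \in A by rewrite gen_in_tail ?leq_addr.
have /coords_eq := triv _ gA; rewrite ?(aut_tail_pow _ stA) // => /(_ gA isT).
rewrite (layer_mx_pow _ autA mM) // coords_gen -colE => /colP/(_ i).
by rewrite !mxE eqxx andbT => ->.
Qed.

Lemma layer_mx_unit (alpha : {perm gT}) M : alpha \in Aut G -> expmatrix g alpha M ->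
  {in A, forall h, alpha h \in A} -> {in B, forall h, alpha h \in B} ->
  layer_mx M ^+ #[alpha] = 1 /\ layer_mx M \in unitmx.
Proof.
move=> autA mM stA stB.
have M1 : layer_mx M ^+ #[alpha] = 1.
  by apply/(layer_mx_pow1 _ autA mM) => // h hA; rewrite expg_order perm1 mulVg.
split=> //; have := unitmx1 'F_p l; rewrite -[1%:M]M1 -(prednK (order_gt0 alpha)) exprS.
by rewrite -mulmxE unitmx_mul => /andP[].
Qed.

(** The affine map h |-> w alpha(h) induces v |-> M v + u on coordinates, where u
    are the coordinates of w. *)
Lemma layer_affine (alpha : {perm gT}) M w k : alpha \in Aut G -> expmatrix g alpha M ->
  {in A, forall h, alpha h \in A} -> {in B, forall h, alpha h \in B} -> w \in A ->
  iter k (affine_map w alpha) 1%g \in A /\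
  coords (iter k (affine_map w alpha) 1%g) =
  iter k (affine_step (layer_mx M) (coords w)) 0.
Proof.
move=> autA mM stA stB wA; elim: k => [|k [IA IH]] /=; first by rewrite group1 coords1.
rewrite /affine_map groupM ?stA //; split=> //.
by rewrite coordsM ?stA // (layer_mxP autA mM stA stB) // IH addrC.
Qed.
End Layer.

(** * Powers in abelian groups *)

Definition radical n := (\prod_(p <- primes n) p)%N.

Lemma logn_prod_primes p s : prime p -> all prime s -> logn p (\prod_(q <- s) q)%N = count_mem p s.
Proof.
move=> pr; elim: s => [|q s IH] /=; first by rewrite big_nil logn1.
case/andP=> prq prs; have s0 : 0 < (\prod_(q <- s) q)%N.
  by rewrite big_seq; apply: prodn_cond_gt0 => r /(allP prs)/prime_gt0.
rewrite big_cons lognM ?(prime_gt0 prq) //.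
by rewrite IH // logn_prime // eq_sym.
Qed.

Lemma all_prime_primes n : all prime (primes n).
Proof. by apply/allP => p; rewrite mem_primes => /andP[]. Qed.

Lemma radical_gt0 n : 0 < radical n.
Proof.
rewrite /radical big_seq; apply: prodn_cond_gt0 => r.
by rewrite mem_primes => /andP[/prime_gt0].
Qed.

Lemma prime_dvd_radical p n : 0 < n -> prime p -> p %| n -> p %| radical n.
Proof.
move=> n0 pr pn; rewrite /radical (big_rem p) ?dvdn_mulr //=.
by rewrite mem_primes pr n0.
Qed.

(** A divisor of a squarefree number is the product of its primes. *)
Lemma radical_dvd o a b : o %| radical a -> 0 < b -> o %| b -> o %| radical b.
Proof.
move=> oa b0 ob; have o0 : 0 < o by apply: dvdn_gt0 oa; apply: radical_gt0.
apply/dvdn_partP => // p; rewrite mem_primes => /and3P[pr _ po].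
have : logn p o <= 1.
  apply: leq_trans (dvdn_leq_log p (radical_gt0 a) oa) _.
  rewrite logn_prod_primes ?all_prime_primes // count_uniq_mem ?primes_uniq //.
  by case: (_ \in _).
rewrite p_part; case: (logn p o) => [|[]] // _.
by rewrite expn1 prime_dvd_radical // (dvdn_trans po).
Qed.

Section Powers.
Variable gT : finGroupType.
Implicit Types G H K L V : {group gT}.

Definition powers (V : {set gT}) n := [set x ^+ n | x in V].

Lemma powers_gen V n : abelian V -> <<powers V n>> = powers V n.
Proof.
move=> abV; apply: gen_set_id; apply/group_setP; split.
  by apply/imsetP; exists 1; rewrite ?expg1n.
move=> _ _ /imsetP[x xV ->] /imsetP[y yV ->]; apply/imsetP.
exists (x * y); rewrite ?groupM // expgMn //.
by apply: (centsP abV).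
Qed.

(** In an abelian group, raising to the n-th power is an endomorphism; an element
    of order p lies in its kernel, so it is not surjective. *)
Lemma powers_proper V n p : abelian V -> prime p -> p %| #|V| -> p %| n ->
  <<powers V n>> \proper V.
Proof.
move=> abV pr pV pn; rewrite powers_gen // properEcard; apply/andP; split.
  by apply/subsetP => _ /imsetP[x xV ->]; rewrite groupX.
rewrite ltn_neqAle leq_imset_card andbT; apply/imset_injP => inj.
have [x xV ox] := Cauchy pr pV.
have := inj x 1 xV (group1 V); rewrite expg1n.
have -> : x ^+ n = 1 by apply/eqP; rewrite -order_dvdn ox.
by move=> /(_ erefl) x1; rewrite x1 order1 in ox; rewrite -ox in pr.
Qed.

Lemma char_powers H G n : H \char G -> <<powers H n>>%G \char G.
Proof.
move=> /charP[sHG chH]; apply/charP.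
have sPG : powers H n \subset G.
  by apply/subsetP => _ /imsetP[x xH ->]; rewrite groupX // (subsetP sHG).
split=> [|f injf fG]; first by rewrite gen_subG.
rewrite /= morphim_gen // -{2}(chH f injf fG); congr <<_>>.
rewrite !morphimEsub //; apply/setP => y; apply/imsetP/imsetP.
  case=> _ /imsetP[x xH ->] ->; exists (f x); first exact: imset_f.
  by rewrite morphX // (subsetP sHG).
case=> _ /imsetP[x xH ->] ->; exists (x ^+ n); first exact: imset_f.
by rewrite morphX // (subsetP sHG).
Qed.

(** An abelian group is the direct product of its Sylow subgroups, and these are
    elementary abelian exactly when the exponent is squarefree. *)
Lemma dprod_of_abelemsP V : abelian V ->
  reflect {in V, forall x, x ^+ radical #|V| = 1} (dprod_of_abelems V).
Proof.
move=> abV; apply: (iffP existsP) => [[F /andP[/forall_inP abF /eqP defV]] x xV | powV].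
  have sV : V \subset Group (group_Ldiv (radical #|V|) abV).
    rewrite -{1}(bigdprodWY defV) gen_subG; apply/bigcupsP => E EF.
    have sEV : E \subset V by rewrite -(bigdprodWY defV) sub_gen // (bigcup_max E).
    apply/subsetP => y yE; apply/LdivP; split; first exact: subsetP sEV y yE.
    have /is_abelemP[p pr abE] := abF E EF.
    have [E1 | ntE] := eqsVneq E 1.
      by move: yE; rewrite E1 => /set1P->; rewrite expg1n.
    have [_ pE _] := pgroup_pdiv (abelem_pgroup abE) ntE.
    have [_ /(_ y yE) yp] := elimT (abelemP pr) abE.
    apply/eqP; rewrite -order_dvdn; apply: dvdn_trans (_ : #[y] %| p) _.
      by rewrite order_dvdn yp.
    by rewrite prime_dvd_radical ?cardG_gt0 // (dvdn_trans pE) // cardSg.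
  by have /LdivP[] := subsetP sV x xV.
have nilV := abelian_nil abV.
pose s := [seq ('O_p(V)%G : {group gT}) | p : nat <- primes #|V|].
have uniq_s : uniq s.
  rewrite map_inj_in_uniq ?primes_uniq // => p q.
  rewrite !mem_primes => /and3P[prp _ pV] /and3P[prq _ qV] epq.
  apply/eqP; apply: contraLR isT => neq.
  have ntO : 'O_p(V) != 1.
    rewrite -cardG_gt1 (card_Hall (nilpotent_pcore_Hall p nilV)) p_part_gt1.
    by rewrite mem_primes prp cardG_gt0.
  have [_ pO _] := pgroup_pdiv (pcore_pgroup p V) ntO.
  have eO : 'O_p(V) = 'O_q(V) := congr1 (@gval gT) epq.
  have := pcore_pgroup q V; rewrite -eO => /pgroupP/(_ p prp pO).
  by rewrite inE /= (negPf neq).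
exists [set E in s]; apply/andP; split.
  apply/forall_inP => E; rewrite inE => /mapP[p]; rewrite mem_primes => /and3P[pr _ pV] ->.
  apply/is_abelemP; exists p => //; apply/abelemP => //; split.
    exact: abelianS (pcore_sub _ _) abV.
  move=> y yO; have yV := subsetP (pcore_sub p V) y yO.
  apply/eqP; rewrite -order_dvdn.
  have : #[y] %| radical #|V| by rewrite order_dvdn powV.
  move=> /radical_dvd/(_ (cardG_gt0 'O_p(V))); rewrite order_dvdG // => /(_ isT).
  move=> /dvdn_trans; apply; rewrite /radical.
  have : {subset primes #|'O_p(V)| <= [:: p]}.
    move=> q; rewrite mem_primes inE => /and3P[prq _ qO].
    by have /pgroupP/(_ q prq qO) := pcore_pgroup p V.
  case: (primes _) (primes_uniq #|'O_p(V)|) => [|q [|r t]] /=; first by rewrite big_nil.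
    by move=> _ /(_ q (mem_head _ _)); rewrite inE big_seq1 => /eqP->.
  move=> + sub; have := sub q (mem_head _ _); have := sub r.
  by rewrite !inE eqxx orbT => /(_ isT)/eqP-> /eqP->; rewrite eqxx.
apply/eqP; rewrite -[RHS](nilpotent_Fitting nilV) /= /Fitting.
under eq_bigl do rewrite inE.
by rewrite -big_uniq // big_map.
Qed.
End Powers.

(** * Lower elementary central series and lower nilpotent series *)

Section LowerElementary.
Variable gT : finGroupType.
Implicit Types G H K L V : {group gT}.

Lemma sub_abelian_powers H K L n : K \subset H -> L <| H -> [~: K, H] \subset L ->
  powers K n \subset L ->
  abelian (K / L) /\ {in K / L, forall y, y ^+ n = 1}.
Proof.
move=> sKH nLH comL powL; have nL := normal_norm nLH.
split.
  rewrite /abelian quotient_cents2 ?(subset_trans sKH) //.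
  by apply: subset_trans comL; apply: commgS.
move=> _ /morphimP[x Nx xK ->]; rewrite -morphX //; apply: coset_id.
by apply: (subsetP powL); apply: imset_f.
Qed.

(** An explicit generating set for the smallest subgroup L with K / L central and
    a product of elementary abelian groups: the first condition says that L
    contains [K, H], the second that it contains the powers.  In this form the
    subgroup is visibly characteristic. *)
Lemma lower_elementary_nextE H K : K <| H ->
  lower_elementary_next H K = ([~: K, H] <*> <<powers K (radical #|K|)>>)%G.
Proof.
move=> nKH; have sKH := normal_sub nKH; set n0 := radical _; set L0 := (_ <*> _)%G.
have nL0 : L0 <| H.
  apply: normalY; first by rewrite /normal commg_normr // comm_subG.
  apply: char_normal_trans nKH; exact: (char_powers n0 (char_refl K)).
have comL0 : [~: K, H] \subset L0 by apply: joing_subl.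
have powL0 : powers K n0 \subset L0 by apply: subset_trans (subset_gen _) (joing_subr _ _).
have sL0K : L0 \subset K.
  rewrite join_subG commg_subl (normal_norm nKH) gen_subG /=.
  by apply/subsetP => _ /imsetP[x xK ->]; rewrite groupX.
apply: val_inj => /=; apply/eqP; rewrite eqEsubset; apply/andP; split.
  apply: (bigcap_inf L0); rewrite nL0 sL0K /=; apply/andP; split.
    by rewrite subsetI quotientS // quotient_cents2 ?(subset_trans sKH) // (normal_norm nL0).
  have [abQ powQ] := sub_abelian_powers sKH nL0 comL0 powL0.
  apply/dprod_of_abelemsP => // y yQ; apply/eqP; rewrite -order_dvdn.
  apply: (@radical_dvd _ #|K|); rewrite ?cardG_gt0 ?order_dvdG //.
  by rewrite order_dvdn powQ.
apply/bigcapsP => L /and4P[nLH sLK cent dpr].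
have nL := normal_norm nLH.
rewrite join_subG; apply/andP; split.
  rewrite -quotient_cents2 ?(subset_trans sKH) //.
  exact: subset_trans cent (subsetIr _ _).
have abQ : abelian (K / L).
  by apply: abelianS cent (center_abelian _).
rewrite gen_subG; apply/subsetP => _ /imsetP[x xK ->].
have xN : x \in 'N(L) by apply: (subsetP nL); apply: (subsetP sKH).
apply: coset_idr; first exact: groupX.
rewrite morphX //; apply/eqP; rewrite -order_dvdn.
have xQ : coset L x \in K / L by apply: mem_quotient.
have := dprod_of_abelemsP abQ dpr _ xQ => /eqP; rewrite -order_dvdn.
move=> /radical_dvd; apply; first exact: cardG_gt0.
by apply: dvdn_trans (order_dvdG xQ) _; rewrite card_quotient ?dvdn_indexg ?(subset_trans sKH).
Qed.

Lemma lower_elementary_next_char H K : K \char H -> lower_elementary_next H K \char H.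
Proof.
move=> chK; rewrite lower_elementary_nextE ?char_normal //.
by apply: charY; [apply: charR (char_refl _) | apply: char_powers].
Qed.

(** In a nilpotent group [K, H] is smaller than K, and in the nontrivial abelian
    group K / [K, H] the powers in question form a proper subgroup. *)
Lemma lower_elementary_next_proper H K : nilpotent H -> K <| H -> K :!=: 1 ->
  lower_elementary_next H K \proper K.
Proof.
move=> nilH nKH ntK; rewrite lower_elementary_nextE //.
have sKH := normal_sub nKH.
pose D := [~: K, H]%G; have nDH : D <| H by rewrite /normal commg_normr comm_subG.
have sDK : D \subset K by rewrite commg_subl (normal_norm nKH).
have pDK : D \proper K.
  rewrite properE sDK /=; apply: contra ntK => sKD.
  by have /forall_inP/(_ K) := nilH; rewrite subsetI sKH sKD => /(_ isT).
have nDK : D <| K := normalS sDK sKH nDH.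
have abV : abelian (K / D).
  by rewrite /abelian quotient_cents2 ?(normal_norm nDK) // commgS.
have ntV : #|K / D| > 1.
  rewrite card_quotient ?normal_norm // indexg_gt1; by case/andP: pDK.
have [p pr pV] : exists2 p, prime p & p %| #|K / D|
  by exists (pdiv #|K / D|); rewrite ?pdiv_prime ?pdiv_dvd.
have pn : p %| radical #|K|.
  apply: prime_dvd_radical; rewrite ?cardG_gt0 //; apply: dvdn_trans pV _.
  by rewrite card_quotient ?normal_norm // dvdn_indexg.
have := powers_proper abV pr pV pn; rewrite !properE => /andP[_ npr]; apply/andP; split.
  rewrite join_subG sDK gen_subG /=.
  by apply/subsetP => _ /imsetP[x xK ->]; rewrite groupX.
apply: contra npr => sK; have nDP : powers K (radical #|K|) \subset 'N(D).
  apply: subset_trans (normal_norm nDK).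
  by apply/subsetP => _ /imsetP[x xK ->]; rewrite groupX.
apply: (@subset_trans _ _ (<< powers K (radical #|K|)>> / D)).
  apply: subset_trans (quotientS D sK) _.
  by rewrite /= quotientYidl // gen_subG.
rewrite quotient_gen // genS //; apply/subsetP => _ /morphimP[_ _ /imsetP[x xK ->] ->].
have xN : x \in 'N(D) by apply: (subsetP (normal_norm nDK)).
rewrite morphX //; apply: imset_f; exact: mem_quotient.
Qed.

Lemma lower_elementaryS H j : lower_elementary H j.+2 =
  lower_elementary_next H (lower_elementary H j.+1).
Proof. by []. Qed.

Lemma lower_elementary_char H j : lower_elementary H j.+1 \char H.
Proof.
elim: j => [|j IH]; first exact: char_refl.
by rewrite lower_elementaryS lower_elementary_next_char.
Qed.

Lemma lower_elementary_sub H j : lower_elementary H j.+2 \subset lower_elementary H j.+1.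
Proof.
have nK := char_normal (lower_elementary_char H j).
rewrite lower_elementaryS lower_elementary_nextE // join_subG.
rewrite commg_subl (normal_norm nK) gen_subG /=.
by apply/subsetP => _ /imsetP[x xK ->]; rewrite groupX.
Qed.

(** Every nontrivial term has smaller order than its predecessor. *)
Lemma lower_elementary_trivial H j : nilpotent H -> #|H| <= j.+1 ->
  lower_elementary H j.+1 :=: 1.
Proof.
move=> nilH leH; apply/eqP/idPn => nt.
suff : #|lower_elementary H j.+1| + j <= #|H|.
  move=> /leq_trans/(_ leH); rewrite addnC -[X in _ <= X]addn1 leq_add2l => le1.
  by rewrite trivg_card_le1 le1 in nt.
elim: j nt {leH} => [|j IH] nt; first by rewrite addn0.
have ntK : lower_elementary H j.+1 :!=: 1.
  by apply: contra nt => /eqP e1; rewrite -subG1 -e1 lower_elementary_sub.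
apply: leq_trans (IH ntK); rewrite addnS ltn_add2r proper_card //.
exact: lower_elementary_next_proper nilH (char_normal (lower_elementary_char H j)) ntK.
Qed.

Lemma lower_elementary_comm H j :
  [~: lower_elementary H j.+1, H] \subset lower_elementary H j.+2.
Proof.
have nK := char_normal (lower_elementary_char H j).
by rewrite lower_elementaryS lower_elementary_nextE // joing_subl.
Qed.

Lemma lower_elementary_powers H j : let K := lower_elementary H j.+1 in
  powers K (radical #|K|) \subset lower_elementary H j.+2.
Proof.
have nK := char_normal (lower_elementary_char H j).
rewrite lower_elementaryS lower_elementary_nextE //.
exact: subset_trans (subset_gen _) (joing_subr _ _).
Qed.

Lemma lower_central_limit_char H : lower_central_limit H \char H.
Proof. exact: lcn_char. Qed.

(** Already a quotient by any term of the lower central series is nilpotent. *)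
Lemma lower_central_limit_nilpotent H : nilpotent (H / lower_central_limit H).
Proof.
apply/lcnP; exists #|H|.-1; rewrite prednK ?cardG_gt0 // -morphim_lcn ?lcn_norm //.
exact: trivg_quotient.
Qed.

(** The limit is contained in the derived subgroup. *)
Lemma lower_central_limit_proper H : solvable H -> H :!=: 1 ->
  lower_central_limit H \proper H.
Proof.
move=> solH ntH; apply: sub_proper_trans (sol_der1_proper solH (subxx H) ntH).
rewrite -lcn2; apply: lcn_sub_leq; by rewrite cardG_gt1.
Qed.

Lemma lower_nilpotent_char G i : lower_nilpotent G i.+1 \char G.
Proof.
elim: i => [|i IH]; first exact: char_refl.
exact: char_trans (lower_central_limit_char _) IH.
Qed.

Lemma lower_nilpotent_trivial G : solvable G -> lower_nilpotent G #|G|.+1 :=: 1.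
Proof.
move=> solG; apply/eqP/idPn => nt.
suff gen j : lower_nilpotent G j.+1 :!=: 1 -> #|lower_nilpotent G j.+1| + j <= #|G|.
  by have := gen _ nt; rewrite -[X in _ <= X]add0n leq_add2r leqNgt cardG_gt0.
elim: j => [|j IH] {}nt; first by rewrite addn0.
have ntK : lower_nilpotent G j.+1 :!=: 1.
  apply: contra nt => /eqP e1; rewrite -subG1 -e1.
  exact: char_sub (lower_central_limit_char _).
apply: leq_trans (IH ntK); rewrite addnS ltn_add2r proper_card //.
apply: lower_central_limit_proper ntK; apply: solvableS solG.
exact: char_sub (lower_nilpotent_char _ _).
Qed.
End LowerElementary.

(** * The LG-series *)

Lemma powers_mul (gT : finGroupType) (V : {set gT}) m n : powers (powers V m) n = powers V (m * n).
Proof.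
apply/setP => y; apply/imsetP/imsetP => [[_ /imsetP[x xV ->] ->] | [x xV ->]].
  by exists x; rewrite // expgM.
by exists (x ^+ m); [apply: imset_f | rewrite expgM].
Qed.

Section Chain.
Variable gT : finGroupType.
Implicit Types G H K L V N : {group gT}.

(** The relation between consecutive terms of the LG-series. *)
Definition elementary_step G H K : Prop :=
  [/\ K \proper H, K \char G, {in H &, forall h u, [~ h, u] \in K}
    & exists2 q, prime q & {in H, forall h, h ^+ q \in K}].

(** Descending chains from H to K in which, as in [LG_refined_step], the last
    group K is not listed, so that chains can be concatenated. *)
Fixpoint elementary_chain G H (l : seq {group gT}) K : Prop :=
  if l is L :: l' then L = H /\ exists2 H', elementary_step G H H' & elementary_chain G H' l' K
  else H = K.

Lemma elementary_chain_cat G H K L l1 l2 :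
  elementary_chain G H l1 K -> elementary_chain G K l2 L ->
  elementary_chain G H (l1 ++ l2) L.
Proof.
elim: l1 H => [|x l1 IH] H /=; first by move=> ->.
by move=> [-> [H' st /IH ch]] /ch; split=> //; exists H'.
Qed.

Lemma elementary_chain_nth G H K l : elementary_chain G H l K ->
  nth K l 0 = H /\ (forall i, i < size l -> elementary_step G (nth K l i) (nth K l i.+1)).
Proof.
elim: l H => [|x l IH] H /=; first by move=> ->.
move=> [-> [H' st /IH[e0 sts]]]; split=> // -[_|i]; first by rewrite /= e0.
exact: sts.
Qed.

(** In the abelian group H / K the powers already form a subgroup. *)
Lemma power_preimageE H K q : K <| H -> abelian (H / K) ->
  K \subset power_preimage K H q /\ power_preimage K H q / K = powers (H / K) q.
Proof.
move=> nKH abQ; have sKH := normal_sub nKH.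
have eP : <<powers (H / K) q>> = powers (H / K) q by apply: powers_gen.
have sPQ : <<powers (H / K) q>> \subset H / K.
  by rewrite eP; apply/subsetP => _ /imsetP[x xV ->]; rewrite groupX.
have sub : coset K @*^-1 <<powers (H / K) q>> \subset H.
  by rewrite -{2}(quotientGK nKH) morphpreS.
have -> : power_preimage K H q = (coset K @*^-1 <<powers (H / K) q>>)%G.
  by apply: val_inj; rewrite /= (setIidPr sub).
by split; [exact: sub_cosetpre | rewrite /= cosetpreK].
Qed.

(** In H / K, taking p-th powers for the primes dividing the order, one after the
    other, removes the Sylow subgroups one at a time and ends with the trivial
    group, because the exponent is squarefree. *)
Lemma refined_chain G H K n : H \char G -> K \char G -> K \subset H ->
  {in H &, forall h u, [~ h, u] \in K} -> {in H, forall h, h ^+ radical n \in K} ->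
  elementary_chain G H (belast H (scanl (power_preimage K) H (primes #|H / K|))) K.
Proof.
move=> chH chK sKH comK powK.
have nKH : K <| H := normalS sKH (char_sub chH) (char_normal chK).
have abQ : abelian (H / K).
  rewrite /abelian quotient_cents2 ?normal_norm // gen_subG.
  by apply/subsetP => _ /imset2P[x y xH yH ->]; apply: comK.
set Q := (H / K)%G in abQ *.
have powQ : {in Q, forall y, y ^+ radical #|Q| = 1}.
  move=> y yQ; apply/eqP; rewrite -order_dvdn; apply: (@radical_dvd _ n).
  - rewrite order_dvdn; case/morphimP: yQ => x Nx xH ->; rewrite -morphX //=.
    by rewrite coset_id //; apply: powK.
  - exact: cardG_gt0.
  - exact: order_dvdG.
(* m is the product of the primes already used, ps lists the remaining ones. *)
suff gen m ps H' : (m * \prod_(p <- ps) p)%N = radical #|Q| -> uniq ps -> all prime ps ->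
    (forall p, p \in ps -> p %| #|Q|) -> (forall p, p \in ps -> coprime p m) ->
    K \subset H' -> H' \subset H -> H' \char G -> H' / K = powers Q m ->
    elementary_chain G H' (belast H' (scanl (power_preimage K) H' ps)) K.
  apply: (gen 1%N); rewrite ?mul1n ?primes_uniq ?all_prime_primes //.
  - by move=> p; rewrite mem_primes => /and3P[].
  - by move=> p _; apply: coprimen1.
  - by apply/setP => y; apply/idP/imsetP => [yQ | [x xQ ->] //]; exists y.
elim: ps m H' => [|q ps IH] m H' em ups prs dvs cop sKH' sH'H chH' eH' /=.
  rewrite big_nil muln1 in em; apply: val_inj; apply/eqP; rewrite eqEsubset sKH' andbT.
  have nH' := subset_trans sH'H (normal_norm nKH).
  rewrite -quotient_sub1 // eH' em; apply/subsetP => _ /imsetP[x xQ ->].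
  by rewrite powQ // set11.
have em' : (m * q * \prod_(p <- ps) p)%N = radical #|Q|.
  by rewrite -mulnA; move: em; rewrite big_cons.
split=> //; case/andP: ups => nq ups; case/andP: prs => prq prs.
have nKH' : K <| H' := normalS sKH' sH'H nKH.
have abQ' : abelian (H' / K) by apply: abelianS (quotientS K sH'H) abQ.
set H2 := power_preimage K H' q.
have [sKH2 eH2] := power_preimageE q nKH' abQ'; rewrite -/H2 in sKH2 eH2.
have sH2H' : H2 \subset H' by apply: subsetIl.
have eH2' : H2 / K = powers Q (m * q). by rewrite eH2 eH' powers_mul.
have nH'K := subsetP (normal_norm nKH').
have powH2 : {in H', forall h, h ^+ q \in H2}.
  move=> h hH; have hN := nH'K h hH.
  have : coset K (h ^+ q) \in H2 / K.
    by rewrite morphX // eH2; apply: imset_f; apply: mem_quotient.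
  by rewrite -{2}(quotientGK (normalS sKH2 sH2H' nKH')) => ?; rewrite mem_morphpre // groupX.
have chH2 : H2 \char G.
  rewrite (_ : H2 = (K <*> <<powers H' q>>)%G); first by rewrite charY ?char_powers.
  apply: val_inj; apply/eqP; rewrite eqEsubset /= join_subG sKH2 gen_subG /=.
  apply/andP; split; last by apply/subsetP => _ /imsetP[x xH ->]; apply: powH2.
  apply/subsetP => y yH2; have yH' := subsetP sH2H' y yH2.
  have : coset K y \in H2 / K by apply: mem_quotient.
  rewrite eH2 => /imsetP[_ /morphimP[h hN hH ->] ey].
  rewrite -(mulKVg (h ^+ q) y) groupM //.
    by apply: (subsetP (joing_subr _ _)); apply: mem_gen; apply: imset_f.
  apply: (subsetP (joing_subl _ _)); apply: coset_idr.
    by rewrite groupM ?groupV ?groupX // nH'K.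
  by rewrite morphM ?groupV ?groupX ?nH'K // morphV ?groupX // morphX //= ey mulVg.
exists H2.
  split=> //.
  - rewrite properE sH2H' /=; apply/negP => sH'H2.
    (* An element y of order q is an m-th power, but not an (m q)-th power: this
       would make q divide the product of the remaining primes. *)
    have [y yQ oy] := Cauchy prq (dvs q (mem_head _ _)).
    have cqm : coprime q m := cop q (mem_head _ _).
    have yH' : y \in H' / K.
      rewrite eH'; apply/imsetP.
      have [a ea] : exists a, m * a = 1 %[mod q].
        have m0 : 0 < m by have := radical_gt0 #|Q|; rewrite -em muln_gt0 => /andP[].
        case: (egcdnP q m0) => a b ea _; exists a.
        by rewrite mulnC ea gcdnC (eqP cqm) modnMDl.
      exists (y ^+ a); first exact: groupX.
      by rewrite -expgM mulnC; apply/eqP; rewrite -{1}[y]expg1 eq_expg_mod_order oy ea.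
    have : y \in H2 / K by apply: (subsetP (quotientS K sH'H2)).
    rewrite eH2' => /imsetP[z zQ ey].
    have : y ^+ (\prod_(p <- ps) p) = 1.
      by rewrite ey -expgM em' powQ.
    move/eqP; rewrite -order_dvdn oy => dvq.
    have : 0 < logn q (\prod_(p <- ps) p)%N.
      rewrite logn_gt0 mem_primes prq dvq andbT /=.
      by have := radical_gt0 #|Q|; rewrite -em' muln_gt0 => /andP[].
    by rewrite logn_prod_primes // -has_count has_pred1 (negPf nq).
  - by move=> h u hH uH; apply: (subsetP sKH2); apply: comK; apply: (subsetP sH'H).
  - by exists q.
apply: (IH (m * q)%N) => //.
- by move=> p pps; apply: dvs; rewrite inE pps orbT.
- move=> p pps; rewrite coprimeMr cop ?inE ?pps ?orbT //=.
  have prp := allP prs p pps; rewrite prime_coprime // dvdn_prime2 //.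
  by apply: contraNneq nq => <-.
- exact: subset_trans sH2H' sH'H.
Qed.
End Chain.

Section LGTerms.
Variables (gT : finGroupType) (G : {group gT}).
Hypothesis solG : solvable G.

Section Level.
Variable k : nat.
Local Notation N := (lower_nilpotent G k.+1).
Local Notation N' := (lower_nilpotent G k.+2).
Local Notation T j := (lower_elementary (N / N')%G j.+1).

Let nN : N' <| N.
Proof. exact: char_normal (lower_central_limit_char N). Qed.

(** The terms of the lower elementary central series of N / N' are contained in
    N / N', so intersecting their preimages with N changes nothing. *)
Lemma LG_termE j : LG_term G k.+1 j.+1 :=: coset N' @*^-1 (T j).
Proof.
apply/setIidPr; rewrite -[in X in _ \subset X](quotientGK nN) morphpreS //.
exact: char_sub (lower_elementary_char _ _).
Qed.

Lemma LG_term_quotient j : LG_term G k.+1 j.+1 / N' = T j.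
Proof. by rewrite LG_termE cosetpreK. Qed.

Lemma LG_term_char j : LG_term G k.+1 j.+1 \char G.
Proof.
apply: char_trans (lower_nilpotent_char G k).
apply: (char_from_quotient (H := N')) (lower_central_limit_char N) _.
  apply: (normalS _ _ nN); last exact: subsetIl.
  by rewrite LG_termE sub_cosetpre.
rewrite LG_term_quotient; exact: lower_elementary_char.
Qed.

Lemma LG_term_first : LG_term G k.+1 1 = N.
Proof. by apply: group_inj; rewrite LG_termE /= quotientGK. Qed.

(** The index bound |G| is generous: the lower elementary central series of the
    nilpotent group N / N' reaches 1 within |N / N'| steps. *)
Lemma LG_term_last : LG_term G k.+1 #|G|.+1 = N'.
Proof.
apply: group_inj; rewrite LG_termE /= lower_elementary_trivial ?lower_central_limit_nilpotent //.
  by rewrite -[1](trivg_quotient N') quotientGK ?normal_refl.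
rewrite leqW // (leq_trans (leq_quotient _ _)) // subset_leq_card //.
exact: char_sub (lower_nilpotent_char G k).
Qed.

Lemma LG_refined_stepP j : elementary_chain G (LG_term G k.+1 j.+1)
  (LG_refined_step G k.+1 j.+1) (LG_term G k.+1 j.+2).
Proof.
have sHN : LG_term G k.+1 j.+1 \subset N by apply: subsetIl.
have nHN' := subset_trans sHN (normal_norm nN).
have mem h : h \in LG_term G k.+1 j.+1 -> h \in 'N(N') /\ coset N' h \in T j.
  move=> hH; split; first exact: (subsetP nHN').
  by rewrite -LG_term_quotient mem_quotient.
apply: (refined_chain (n := #|T j|)); try exact: LG_term_char.
- by rewrite !LG_termE morphpreS // lower_elementary_sub.
- move=> h u /mem[hN hT] /mem[uN uT]; rewrite LG_termE mem_morphpre ?groupR //=.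
  rewrite morphR //; apply: (subsetP (lower_elementary_comm _ _)).
  apply: mem_commg => //; apply: subsetP uT; exact: char_sub (lower_elementary_char _ _).
- move=> h /mem[hN hT]; rewrite LG_termE mem_morphpre ?groupX //=.
  rewrite morphX //; apply: (subsetP (lower_elementary_powers _ _)).
  exact: imset_f.
Qed.
End Level.

Lemma LG_level_chain k : elementary_chain G (lower_nilpotent G k.+1)
  (flatten [seq LG_refined_step G k.+1 j | j <- iota 1 #|G|]) (lower_nilpotent G k.+2).
Proof.
rewrite -LG_term_last -LG_term_first.
suff gen m j : elementary_chain G (LG_term G k.+1 j.+1)
   (flatten [seq LG_refined_step G k.+1 j | j <- iota j.+1 m]) (LG_term G k.+1 (j + m).+1).
  exact: (gen #|G| 0).
elim: m j => [|m IH] j /=; first by rewrite addn0.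
by apply: elementary_chain_cat (LG_refined_stepP k j) _; rewrite addnS -addSn; apply: IH.
Qed.

Lemma LG_series_chain : elementary_chain G G (LG_series G) 1%G.
Proof.
have -> : 1%G = lower_nilpotent G #|G|.+1.
  by apply: group_inj; rewrite /= lower_nilpotent_trivial.
rewrite /LG_series; suff gen m k : elementary_chain G (lower_nilpotent G k.+1)
   (flatten [seq LG_refined_step G i j | i <- iota k.+1 m, j <- iota 1 #|G|])
   (lower_nilpotent G (k + m).+1).
  exact: (gen _ 0).
elim: m k => [|m IH] k; first by rewrite addn0.
rewrite /= flatten_cat; apply: elementary_chain_cat (LG_level_chain k) _.
by rewrite addnS -addSn; apply: IH.
Qed.

Lemma LG_seriesP : nth 1%G (LG_series G) 0 = G /\
  (forall i, i < size (LG_series G) ->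
     elementary_step G (nth 1%G (LG_series G) i) (nth 1%G (LG_series G) i.+1)).
Proof. exact: elementary_chain_nth LG_series_chain. Qed.
End LGTerms.

(** * Generating sequences refining the LG-series *)

Section Existence.
Variable gT : finGroupType.
Implicit Types (G H K M : {group gT}) (g s t : seq gT).

Lemma pcgs_consI H M x s : pcgs M s -> M <| H -> prime #|H / M| -> x \in H -> x \notin M ->
  pcgs H (x :: s).
Proof.
move=> pM nMH pr xH xM; have [eM st] := pM.
have eT : tail_group (x :: s) 0 = H.
  apply: group_inj; apply/eqP; rewrite eqEsubset gen_subG; apply/andP; split.
    apply/subsetP => y; rewrite !inE => /predU1P[-> // | ys].
    by apply: (subsetP (normal_sub nMH)); rewrite -eM mem_gen // inE drop0.
  have ps := pcgs_stepI xH nMH xM pr.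
  apply/subsetP => h hH; have [a _ ha] := step_cover ps hH.
  have xT : x \in tail_group (x :: s) 0 by rewrite mem_gen // !inE eqxx.
  have sMT : M \subset tail_group (x :: s) 0.
    by rewrite -eM; apply: (tail_groupS (x :: s) (leq0n 1)).
  by rewrite -(mulKVg (x ^+ a) h) groupM ?groupX // (subsetP sMT).
split=> // -[_ | i]; last exact: (st i).
by rewrite /relative_order tail_group_cons eT eM.
Qed.

(** A maximal normal subgroup M of H above K has prime index as H is solvable;
    any element outside M can be put in front of a pcgs of M. *)
Lemma pcgs_extend H K t : solvable H -> K <| H -> pcgs K t -> exists s, pcgs H (s ++ t).
Proof.
move: {2}#|H| (leqnn #|H|) => n; elim: n H => [|n IH] H leH solH nKH pK.
  by rewrite leqNgt cardG_gt0 in leH.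
have [eKH | neKH] := eqVneq K H; first by exists [::]; rewrite -eKH.
have pKH : K \proper H.
  by rewrite properEneq normal_sub // andbT; apply: contra neKH => /eqP/group_inj->.
pose P (M : {group gT}) := [&& M \proper H, M <| H & K \subset M].
have [|M maxM _] := @maxgroup_exists _ P K; first by rewrite /P pKH nKH subxx.
have /and3P[pMH nMH sKM] := maxgroupp maxM.
have mxM : maxnormal M H H.
  apply/maxgroupP; split; first by rewrite pMH normal_norm.
  move=> L /andP[pL nL] sML; apply: (maxgroupP maxM).2 => //.
  by rewrite /P pL /normal (proper_sub pL) nL (subset_trans sKM).
have pr : prime #|H / M|.
  by apply: simple_sol_prime; rewrite ?quotient_sol ?quotient_simple.
have [||||s ps] := IH M.
- by rewrite -ltnS; apply: leq_trans leH; apply: proper_card.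
- exact: solvableS (proper_sub pMH) solH.
- exact: normalS sKM (proper_sub pMH) nKH.
- exact: pK.
have [_ [x xH xM]] := properP pMH.
by exists (x :: s); apply: pcgs_consI ps nMH pr xH xM.
Qed.

(** Working upwards from the trivial group, each term of the chain becomes a tail
    group. *)
Lemma pcgs_chain G H l : solvable H -> elementary_chain G H l 1%G -> H \subset G ->
  exists2 g, pcgs H g & forall L, L \in l -> exists2 i, i < size g & L = tail_group g i.
Proof.
elim: l H => [|x l IH] H solH /=.
  move=> -> _; exists [::] => //; split=> //; exact: tail_group_oversize.
move=> [-> [H' [pr ch _ _] chain]] sHG.
have sH'H := proper_sub pr.
have [g' pg' ref'] := IH H' (solvableS sH'H solH) chain (subset_trans sH'H sHG).
have nH' : H' <| H := normalS (proper_sub pr) sHG (char_normal ch).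
have [s ps] := pcgs_extend solH nH' pg'.
exists (s ++ g') => // L; rewrite inE => /predU1P[-> | /ref'[i lti ->]].
  exists 0; last by case: ps => ->.
  rewrite lt0n; apply: contraTneq pr => /eqP; rewrite size_eq0 => /eqP e0.
  have /group_inj-> : H :=: 1 by case: ps => <- _; rewrite e0 tail_group_oversize.
  by rewrite properE sub1G andbF.
exists (i + size s); first by rewrite size_cat addnC ltn_add2l.
by rewrite -tail_group_drop drop_size_cat.
Qed.

Lemma LG_pcgs_exists G : solvable G -> exists2 g, pcgs G g & refines_LG G g.
Proof.
move=> solG; have [g pg ref] := pcgs_chain solG (LG_series_chain solG) (subxx G).
by exists g => // H /ref; right.
Qed.

Lemma expvecs_exists G g ys : pcgs G g -> {subset ys <= G} -> exists es, expvecs g ys es.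
Proof.
move=> pG ysG; exists [seq exponents g y | y <- ys]; split; first by rewrite size_map.
move=> i lti; rewrite (nth_map 1) //; apply: exponentsP pG _; apply: ysG.
exact: mem_nth.
Qed.

Lemma presentation_exists G g : pcgs G g -> exists R, presentation_of g R.
Proof.
elim: g G => [|x s IH] G pG; first by exists [::]; split.
have [st ps] := pcgs_cons pG; have [R [szR pres]] := IH _ ps.
have nK := step_normal st; have xG := step_mem st.
have [c hc] : exists c, expvecs s [seq y ^ x | y <- s] c.
  apply: expvecs_exists ps _ => _ /mapP[y ys ->].
  rewrite memJ_norm ?(subsetP (normal_norm nK)) //.
  by rewrite mem_gen // inE drop0.
have [b hb] : exists b, expvec s (x ^+ relative_order (x :: s) 0) b.
  apply: expvec_exists ps _; rewrite (relative_order0 pG).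
  have xN := subsetP (normal_norm nK) x xG.
  apply: coset_idr; first exact: groupX.
  by rewrite morphX //; apply: expg_cardG; apply: mem_quotient.
exists (PcRel (relative_order (x :: s) 0) b c :: R); split; first by rewrite /= szR.
case=> [_ | i lti]; last exact: pres.
by rewrite /= drop0.
Qed.

Lemma LG_data_exists G X R (alpha : {perm gT}) A (ys : seq gT) es : solvable G -> pcgs G X ->
  presentation_of X R -> alpha \in Aut G -> expmatrix X alpha A ->
  {subset ys <= G} -> expvecs X ys es -> exists D, LG_data_spec R A es D.
Proof.
move=> solG pX pres autA mA ysG yse.
have [g pg ref] := LG_pcgs_exists solG.
have gG : {subset g <= G}.
  by move=> y; apply: pcgs_gen_mem pg.
have [gs hgs] := expvecs_exists pX gG.
have [R' pR'] := presentation_exists pg.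
have [B hB] : exists B, expmatrix g alpha B.
  by apply: expvecs_exists pg _ => _ /mapP[y /gG yG ->]; apply: aut_mem.
have [fs hfs] := expvecs_exists pg ysG.
exists (LGData gs R' (size (LG_series G)) [seq final_weight G x | x <- g] B fs).
by exists gT, G, X, g, ys, alpha.
Qed.

Lemma pcgs_solvable G g : pcgs G g -> solvable G.
Proof.
elim: g G => [|x s IH] G pG.
  have -> : G = 1%G by case: pG => <- _; rewrite tail_group_oversize.
  exact: solvable1.
have [st ps] := pcgs_cons pG; rewrite (series_sol (step_normal st)) (IH _ ps) /=.
by apply: abelian_sol; apply: cyclic_abelian; apply: prime_cyclic; apply: step_prime st.
Qed.
End Existence.

(** * Weights and layers *)

(** The exponent vector of a generator is a unit vector. *)
Lemma gen_mem_tail (gT : finGroupType) (G : {group gT}) (g : seq gT) c j :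
  pcgs G g -> j < size g -> (nth 1 g j \in tail_group g c) = (c <= j).
Proof.
move=> pG ltj; have he := expvec_gen pG ltj.
apply/idP/idP => [/(iffLR (tail_group_exponents c pG he)) z | lecj].
  rewrite leqNgt; apply/negP => ltjc; have := z j ltjc.
  by rewrite nth_unit_exponents // eqxx.
apply/(tail_group_exponents c pG he) => i ltic.
have ltij : i < j by apply: leq_trans ltic lecj.
by rewrite nth_unit_exponents ?(ltn_trans ltij) // gtn_eqF.
Qed.

Lemma count_ltn c n : c <= n -> count (fun j => j < c) (iota 0 n) = c.
Proof.
move=> lecn; rewrite -(subnKC lecn) iotaD count_cat add0n.
rewrite (eq_in_count (a2 := predT)) => [|i]; last by rewrite mem_iota add0n => /andP[_ ->].
rewrite count_predT size_iota (eq_in_count (a2 := pred0)) ?count_pred0 ?addn0 // => i.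
by rewrite mem_iota leqNgt => /andP[/negPf->].
Qed.

Section LayerFacts.
Variables (gT : finGroupType) (G : {group gT}) (g : seq gT) (D : LG_data).
Hypotheses (pG : pcgs G g) (refG : refines_LG G g).
Hypotheses (presD : presentation_of g (lg_pres D)) (lenD : lg_length D = size (LG_series G)).
Hypothesis weightD : lg_weights D = [seq final_weight G x | x <- g].

Let solG : solvable G := pcgs_solvable pG.
Let L := LG_series G.
Let r := size L.

(** Counting from 0 and taking the value 1 beyond the last term, so that the
    index r stands for the trivial group. *)
Definition LG_group i : {group gT} := nth 1%G L i.
Local Notation Gs := LG_group.

Lemma LG_group0 : Gs 0 = G. Proof. exact: (LG_seriesP solG).1. Qed.

Lemma LG_group_step i : i < r -> elementary_step G (Gs i) (Gs i.+1).
Proof. exact: (LG_seriesP solG).2. Qed.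

Lemma LG_group_sub i j : i <= j -> Gs j \subset Gs i.
Proof.
elim: j => [|j IH]; first by rewrite leqn0 => /eqP->.
rewrite leq_eqVlt => /predU1P[-> // | ]; rewrite ltnS => /IH; apply: subset_trans.
have [ltj | gej] := ltnP j r; first by have [/proper_sub] := LG_group_step ltj.
by rewrite /Gs [nth _ _ j.+1]nth_default ?sub1G // leqW.
Qed.

Lemma LG_group_char i : Gs i \char G.
Proof.
case: i => [|i]; first by rewrite LG_group0 char_refl.
have [lti | gei] := ltnP i r; first by have [_ ch _ _] := LG_group_step lti.
by rewrite /Gs nth_default ?char1 // leqW.
Qed.

Lemma LG_group_tail i : exists2 c, c <= size g & Gs i = tail_group g c.
Proof.
have one : Gs i = 1%G -> exists2 c, c <= size g & Gs i = tail_group g c.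
  by move=> ->; exists (size g) => //; rewrite tail_group_oversize.
have [lti | gei] := ltnP i r; last by apply: one; apply: nth_default.
have [/one // | [c ltc eL]] := refG (mem_nth 1%G lti).
by exists c; first exact: ltnW.
Qed.

(** The series is descending, so the groups containing h form an initial segment.
    The identity has to be excluded for i = r. *)
Lemma final_weightP h i : h \in G -> h != 1 -> i <= r ->
  (final_weight G h <= i) = (h \notin Gs i).
Proof.
move=> hG nth1 leir; apply/idP/idP => [le | hn].
  apply/negP => hGi; have [lti | gei] := ltnP i r; last first.
    by move: hGi nth1; rewrite /Gs nth_default // inE => ->.
  suff : i.+1 <= final_weight G h by rewrite ltnNge le.
  by apply: (leq_bigmax_seq i.+1) => //; rewrite mem_iota add1n ltnS.
apply/bigmax_leqP_seq => w; rewrite mem_iota => /andP[w0 _] hw.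
rewrite leqNgt; apply: contra hn => ltiw; apply: subsetP hw.
by apply: (LG_group_sub (i := i) (j := w.-1)); rewrite -ltnS prednK.
Qed.

Lemma layer_endS i : layer_end D i.+1 = (layer_end D i + layer_size D i.+1)%N.
Proof. by rewrite /layer_end big_nat_recr. Qed.

Lemma layer_end_count i : layer_end D i = count (fun w => 0 < w <= i) (lg_weights D).
Proof.
elim: i => [|i IH].
  rewrite /layer_end big_geq // (eq_count (a2 := pred0)) ?count_pred0 // => w.
  by case: w.
rewrite layer_endS IH /layer_size; elim: (lg_weights D) => //= w s IHs.
rewrite addnACA IHs; congr (_ + _)%N; rewrite [w <= i.+1]leq_eqVlt ltnS.
by case: eqP => [-> | _] /=; rewrite ?ltnn ?addn0.
Qed.

(** The number of generators of weight at most i is the number of generators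
    outside the next term of the series; since that term is a tail group, these
    are the leading ones. *)
Lemma LG_groupE i : i <= r -> layer_end D i <= size g /\ Gs i = tail_group g (layer_end D i).
Proof.
move=> leir; have [c lec eG] := LG_group_tail i.
suff -> : layer_end D i = c by [].
rewrite layer_end_count weightD count_map -{1}(mkseq_nth 1 g) count_map.
rewrite -[RHS](count_ltn lec); apply: eq_in_count => j; rewrite mem_iota add0n => /andP[_ ltj] /=.
have gG := pcgs_gen_mem pG (mem_nth 1 ltj).
have ntg : nth 1 g j != 1.
  apply/negP => /eqP g1; have := gen_mem_tail (size g) pG ltj.
  by rewrite g1 group1 leqNgt ltj.
rewrite final_weightP // eG (gen_mem_tail _ pG) // -ltnNge andb_idl // => _.
by rewrite lt0n -leqn0 final_weightP // LG_group0 gG.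
Qed.

(** A relative order within the layer is the order of an element that is killed by
    the exponent q of the elementary abelian factor, hence equals q; this is also
    why the relative order at the start of the layer is the right prime. *)
Lemma layer_factsP i (a := layer_end D i) (l := layer_size D i.+1) (p := layer_prime D i.+1) :
  i < r ->
  [/\ a + l <= size g, prime p & (forall j, j < l -> relative_order g (a + j) = p)] /\
  [/\ tail_group g a = Gs i, tail_group g (a + l) = Gs i.+1,
      {in tail_group g a &, forall h u, [~ h, u] \in tail_group g (a + l)}
    & {in tail_group g a, forall h, h ^+ p \in tail_group g (a + l)}].
Proof.
move=> lti; have [lea eA] := LG_groupE (ltnW lti).
have [leb eB] := LG_groupE lti; rewrite layer_endS -/a -/l in leb eB.
have [pr _ com [q prq powq]] := LG_group_step lti; rewrite eA eB in pr com powq.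
have l0 : 0 < l.
  rewrite lt0n; apply: contraTneq pr => l0; rewrite -/a l0 addn0 properE subxx //.
have ord j : j < l -> relative_order g (a + j) = q.
  move=> ltj; have ltg : a + j < size g by apply: leq_trans leb; rewrite ltn_add2l.
  have [nT prT] := pG.2 _ ltg.
  have [y yQ oy] := Cauchy prT (dvdnn _).
  apply/eqP; rewrite -dvdn_prime2 // -[X in X %| _]oy order_dvdn.
  case/morphimP: yQ => x Nx xT ->; rewrite -morphX //= coset_id //.
  have xA : x \in tail_group g a by apply: subsetP xT; apply: tail_groupS; apply: leq_addr.
  by apply: subsetP (powq x xA); apply: tail_groupS; rewrite -addnS leq_add2l.
have ep : p = q.
  rewrite /p /layer_prime /= -(ord 0 l0) addn0.
  by case: presD => _ /(_ a) [|-> _ _] //; apply: leq_trans leb; rewrite -addn1 leq_add2l.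
by rewrite ep.
Qed.
End LayerFacts.

(** * The order of an automorphism *)

(** Leading exponents are invariants of the cosets of tail groups. *)
Lemma exponents_agree (gT : finGroupType) (G : {group gT}) (g : seq gT) h u e f c :
  pcgs G g -> expvec g h e -> expvec g u f ->
  h^-1 * u \in tail_group g c <-> (forall i, i < c -> nth 0%N e i = nth 0%N f i).
Proof.
elim: g G h u e f c => [|x s IH] G h u e f c pG he uf.
  move: he uf; case: e => [|? ?]; last by case.
  case: f => [|? ?]; last by move=> _; case.
  by move=> /expvec_nil-> /expvec_nil->; rewrite mulVg group1.
have hG := pcgs_mem pG he; have uG := pcgs_mem pG uf.
case: e he => [[] //|a v] /expvec_cons[lta hv].
case: f uf => [[] //|b w] /expvec_cons[ltb uw].
have [st ps] := pcgs_cons pG; rewrite (relative_order0 pG) in lta ltb.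
case: c => [|c]; first by split=> // _; case: pG => -> _; rewrite groupM ?groupV.
have eq_hu : a = b -> h^-1 * u = (x ^- a * h)^-1 * (x ^- b * u).
  by move=> <-; rewrite invMg invgK -mulgA mulKVg.
rewrite tail_group_cons; split=> [hc | allz].
  have hK : h^-1 * u \in tail_group s 0 by apply: subsetP hc; apply: tail_groupS.
  have eab : a = b.
    apply: (step_inj st lta ltb _ (pcgs_mem ps uw)).
    rewrite -(mulKVg h u) mulgA groupM //; exact: (pcgs_mem ps hv).
  rewrite (eq_hu eab) in hc.
  by case=> [_ | i] //=; apply: (iffLR (IH _ _ _ _ _ c ps hv uw) hc).
have eab : a = b := allz 0 isT.
rewrite (eq_hu eab); apply/(IH _ _ _ _ _ c ps hv uw) => i; exact: (allz i.+1).
Qed.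

(** h^-1 f^(k+1)(h) is the product of h^-1 f^k(h) and y^-1 f(y) for
    y = f^k(h). *)
Lemma aut_pow_trivial (gT : finGroupType) (A B : {group gT}) (f : {perm gT}) k :
  {in A, forall h, f h \in A} -> {in A, forall h, h^-1 * f h \in B} ->
  {in A, forall h, h^-1 * (f ^+ k) h \in B}.
Proof.
move=> stA triv h hA; elim: k => [|k IH]; first by rewrite perm1 mulVg.
have hkA : (f ^+ k) h \in A by apply: aut_tail_pow.
by rewrite -(mulKVg ((f ^+ k) h) ((f ^+ k.+1) h)) mulgA groupM // expgSr permM triv.
Qed.

Section TrivialAction.
Variables (gT : finGroupType) (G N : {group gT}) (g : seq gT) (f : {perm gT}).
Hypotheses (pG : pcgs G g) (autF : f \in Aut G) (nNG : N <| G).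

(** The elements fixed modulo the normal subgroup N form a subgroup. *)
Lemma trivial_on_generators :
  (forall j, j < size g -> (nth 1 g j)^-1 * f (nth 1 g j) \in N) ->
  {in G, forall h, h^-1 * f h \in N}.
Proof.
move=> trivg; pose S := [set h in G | h^-1 * f h \in N].
have nN : {in G, forall h, h \in 'N(N)} by apply/subsetP; apply: normal_norm.
have gS : group_set S.
  apply/group_setP; split; first by rewrite inE group1 (aut_one autF) mulg1 invg1 group1.
  move=> h u; rewrite !inE => /andP[hG hN] /andP[uG uN]; rewrite groupM //=.
  rewrite (aut_mulP autF) //.
  have -> : (h * u)^-1 * (f h * f u) = (h^-1 * f h) ^ u * (u^-1 * f u).
    by rewrite conjgE invMg -!mulgA mulKVg.
  by rewrite groupM // memJ_norm // nN.
have sGS : G \subset Group gS.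
  case: (pG) => {1}<- _; rewrite gen_subG; apply/subsetP => y; rewrite inE drop0 => yg.
  have yG := pcgs_gen_mem pG yg.
  have [j ltj <-] := nthP 1 yg; rewrite !inE trivg // andbT.
  exact: pcgs_gen_mem pG (mem_nth _ ltj).
by move=> h /(subsetP sGS); rewrite inE => /andP[].
Qed.
End TrivialAction.

Section AutOrderBody.
Variables (gT : finGroupType) (G : {group gT}) (g : seq gT) (D : LG_data) (alpha : {perm gT}).
Hypotheses (pG : pcgs G g) (refG : refines_LG G g).
Hypotheses (presD : presentation_of g (lg_pres D)) (lenD : lg_length D = size (LG_series G)).
Hypothesis weightD : lg_weights D = [seq final_weight G x | x <- g].
Hypotheses (autA : alpha \in Aut G) (mA : expmatrix g alpha (lg_matrix D)).

Local Notation Gs := (LG_group G).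
Local Notation r := (lg_length D).

Let chG i : Gs i \char G := LG_group_char pG i.

Lemma LG_group_stable (f : {perm gT}) i : f \in Aut G -> {in Gs i, forall h, f h \in Gs i}.
Proof.
move=> autF h hG; have /andP[_ /forall_inP/(_ f autF)/subsetP] := chG i.
by apply; apply: imset_f.
Qed.

Let nG i : Gs i <| G := char_normal (chG i).
Let sub i : {subset Gs i <= G} := subsetP (normal_sub (nG i)).

Definition layers_fixed n := forall i, i < r ->
  {in Gs i, forall h, h^-1 * (alpha ^+ n) h \in Gs i.+1}.

Definition quotient_fixed i n := {in G, forall h, h^-1 * (alpha ^+ n) h \in Gs i}.

(** The order of M_i is the order of the action on the i-th factor. *)
Lemma layers_orderP :
  returns_some (lcmM (fun i => matrix_order (layer_matrix D (lg_matrix D) i)) (iota 1 r))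
               (period layers_fixed).
Proof.
have layer i : i < r ->
    (layer_matrix D (lg_matrix D) i.+1 ^+ #[alpha] = 1)%R /\
    (forall n, (layer_matrix D (lg_matrix D) i.+1 ^+ n = 1)%R <->
          {in Gs i, forall h, h^-1 * (alpha ^+ n) h \in Gs i.+1}).
  rewrite {1}lenD => lti.
  have [[leg pr ord] [eA eB com pow]] := layer_factsP pG refG presD weightD lti.
  have stA : {in tail_group g (layer_end D i), forall h, alpha h \in tail_group g (layer_end D i)}.
    by rewrite eA; apply: LG_group_stable.
  have stB : {in tail_group g (layer_end D i + layer_size D i.+1), forall h,
      alpha h \in tail_group g (layer_end D i + layer_size D i.+1)}.
    by rewrite eB; apply: LG_group_stable.
  have [M1 _] := layer_mx_unit pG leg pr ord com pow autA mA stA stB.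
  split=> [|n]; first exact: M1.
  rewrite -eA -eB; exact: (layer_mx_pow1 pG leg pr ord com pow n autA mA stA stB).
apply: returns_some_weaken.
  apply: (returns_some_lcmM (Q := fun i n =>
     (layer_matrix D (lg_matrix D) i ^+ n = 1)%R)) => -[|i]; rewrite mem_iota //= => /ltnSE lti.
  have [M1 _] := layer i lti.
  apply: returns_some_least_pos M1; rewrite ?order_gt0 ?expr0 // => m n Mm.
  by rewrite exprD Mm mul1r.
move=> o; apply: eq_period => n; split=> [fx i lti | fx [|i]].
- by have [_ <-] := layer i lti; apply: fx; rewrite mem_iota add1n !ltnS.
- by rewrite mem_iota.
- by rewrite mem_iota add1n !ltnS => /andP[_ lti]; have [_ ->] := layer i lti; apply: fx.
Qed.

(** With z = h^-1 f(h), the element f^m(h) is h z^m modulo the next term, because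
    f fixes z modulo that term. *)
Lemma power_action (f : {perm gT}) i h m : i < r -> f \in Aut G ->
  {in G, forall h, h^-1 * f h \in Gs i} ->
  {in Gs i, forall h, h^-1 * f h \in Gs i.+1} -> h \in G ->
  (h^-1 * (f ^+ m) h \in Gs i.+1) = ((h^-1 * f h) ^+ m \in Gs i.+1).
Proof.
move=> lti autF triv lay hG; set z := h^-1 * f h.
have zG : z \in Gs i by apply: triv.
have sN : Gs i.+1 \subset Gs i := LG_group_sub pG (leqnSn i).
have fmG k : (f ^+ k) h \in G by apply: aut_mem; rewrite // groupX.
(* The two elements agree modulo the next term. *)
suff key : z ^- m * (h^-1 * (f ^+ m) h) \in Gs i.+1.
  rewrite -(mulKVg (z ^+ m) (h^-1 * (f ^+ m) h)); apply/idP/idP => [yN | zN].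
    by rewrite -(groupMr _ key).
  by rewrite groupM.
elim: m => [|m IH]; first by rewrite perm1 mulVg expg0 invg1 mulg1 group1.
set y := h^-1 * (f ^+ m) h in IH.
have yG : y \in Gs i by apply: aut_pow_trivial triv _ hG => u; apply: aut_mem.
have -> : z ^- m.+1 * (h^-1 * (f ^+ m.+1) h) = (z ^- m * y) * (y^-1 * f y).
  have -> : (f ^+ m.+1) h = f h * f y.
    by rewrite expgSr permM -(aut_mulP autF) ?(sub yG) // mulKVg.
  have -> : z ^- m.+1 = z ^- m * ((f h)^-1 * h) by rewrite expgS invMg /z invMg invgK.
  by move: (z ^- m) => zm; clearbody y; rewrite -!mulgA !mulKVg mulKg.
by rewrite groupM // lay.
Qed.

(** Modulo the i-th term nothing moves, so the exponents of f(g_j) in earlier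
    layers are those of g_j; the ones inspected vanish for g_j itself. *)
Lemma loop_testP (f : {perm gT}) B i : i < r -> f \in Aut G -> expmatrix g f B ->
  {in G, forall h, h^-1 * f h \in Gs i} ->
  ~~ has (fun j => has (fun k => entry B j k != 0%N)
              (iota (layer_end D i) (layer_size D i.+1))) (iota 0 (layer_end D i)) <->
  (forall j, j < layer_end D i -> (nth 1 g j)^-1 * f (nth 1 g j) \in Gs i.+1).
Proof.
rewrite {1}lenD => lti autF [szB mB] triv.
have [[leg _ _] [eA eB _ _]] := layer_factsP pG refG presD weightD lti.
set a := layer_end D i in leg eA eB *; set l := layer_size D i.+1 in leg eB *.
have row j : j < size g -> expvec g (f (nth 1 g j)) (nth [::] B j).
  by move=> ltj; have := mB j; rewrite size_map (nth_map 1) //; apply.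
have gG j : j < size g -> nth 1 g j \in G.
  by move=> ltj; apply: pcgs_gen_mem pG (mem_nth _ ltj).
have agree c j : c <= size g -> j < size g ->
   (nth 1 g j)^-1 * f (nth 1 g j) \in tail_group g c <->
   (forall k, k < c -> entry B j k = (j == k) :> nat).
  move=> lec ltj; rewrite (exponents_agree c pG (expvec_gen pG ltj) (row j ltj)).
  split=> H k ltk; have ltkg := leq_trans ltk lec; first by rewrite /entry -H // nth_unit_exponents.
  by rewrite nth_unit_exponents // -H.
have lea : a <= size g by apply: leq_trans leg; apply: leq_addr.
split=> [/hasPn nz j ltj | trivg].
  have ltg := leq_trans ltj lea.
  rewrite -eB; apply/agree => // k ltk; have [ltka | geka] := ltnP k a.
    by apply: (iffLR (agree a j lea ltg)) => //; rewrite eA; apply: triv; apply: gG.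
  rewrite ltn_eqF ?(leq_trans ltj) //; apply/eqP.
  have := nz j; rewrite mem_iota add0n => /(_ ltj)/hasPn/(_ k).
  by rewrite mem_iota geka ltk negbK => /(_ isT).
apply/hasPn => j; rewrite mem_iota add0n => /andP[_ ltj].
apply/hasPn => k; rewrite mem_iota => /andP[geka ltk]; rewrite negbK.
have ltg : j < size g by apply: leq_trans ltj lea.
have := trivg j ltj; rewrite -eB => /(agree _ _ leg ltg)/(_ k ltk)->.
by rewrite eqb0 ltn_eqF // (leq_trans ltj).
Qed.

(** If all generators of the earlier layers are fixed modulo the next term, then so
    is everything, as those of the layer itself and of later layers are fixed
    modulo it anyway.  Otherwise some z = h^-1 beta(h) has order exactly p modulo the next
    term, while all z have order dividing p. *)
Lemma loop_stepP i (s : nat * seq (seq nat)) (p := layer_prime D i.+1) : i < r ->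
  period (fun n => layers_fixed n /\ quotient_fixed i n) s.1 ->
  expmatrix g (alpha ^+ s.1) s.2 ->
  returns_some
   (if has (fun j => has (fun k => entry s.2 j k != 0%N)
                 (iota (layer_end D i) (layer_size D i.+1)))
            (iota 0 (layer_end D i))
    then Ret ((s.1 * p)%N, pc_aut_pow (lg_pres D) s.2 p)
    else Ret s)
   (fun s' => period (fun n => layers_fixed n /\ quotient_fixed i.+1 n) s'.1 /\
              expmatrix g (alpha ^+ s'.1) s'.2).
Proof.
case: s => o B /= lti perO mB.
have lti' : i < size (LG_series G) by rewrite -lenD.
have [[leg pr _] [eA eB _ pow]] := layer_factsP pG refG presD weightD lti'.
rewrite -/p eA eB in pr pow.
have autF : alpha ^+ o \in Aut G by rewrite groupX.
have [layO triv] := iffRL (perO o) (dvdnn o).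
have layI := layO i lti.
have fG : {in G, forall h, (alpha ^+ o) h \in G} by move=> h; apply: aut_mem.
have qS n : quotient_fixed i.+1 n -> quotient_fixed i n.
  move=> q h hG; exact: subsetP (LG_group_sub pG (leqnSn i)) _ (q h hG).
have actP m h : h \in G -> (h^-1 * (alpha ^+ (o * m)) h \in Gs i.+1) =
    ((h^-1 * (alpha ^+ o) h) ^+ m \in Gs i.+1).
  by move=> hG; rewrite expgM; apply: power_action.
have layM m : layers_fixed (o * m) by have [] := iffRL (perO (o * m)%N) (dvdn_mulr m (dvdnn o)).
have test := loop_testP lti autF mB triv.
case: ifPn => [hasN | /test trivg].
  apply: returns_some_ret; split; last first.
    by rewrite expgM; apply: pc_aut_powP autF mB.
  have [h hG nh] : exists2 h, h \in G & (h^-1 * (alpha ^+ o) h) \notin Gs i.+1.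
    have : ~ (forall j, j < layer_end D i -> (nth 1 g j)^-1 * (alpha ^+ o) (nth 1 g j) \in Gs i.+1).
      by move/test; rewrite hasN.
    move=> nall; apply: NNPP => no; apply: nall => j ltj; apply: contraT => nj.
    case: no; exists (nth 1 g j) => //; case: (pG) => <- _; rewrite (gen_mem_tail _ pG) //.
    apply: leq_trans ltj _; apply: leq_trans leg; exact: leq_addr.
  move=> n; split=> [[lay q] | /dvdnP[k ->]].
    have /dvdnP[m en] : o %| n by apply/perO; split=> //; apply: qS.
    rewrite en mulnC in q *; rewrite dvdn_pmul2l; last first.
      rewrite lt0n; apply: contraNneq nh => ->.
      by rewrite expg0 perm1 mulVg group1.
    have zm : (h^-1 * (alpha ^+ o) h) ^+ m \in Gs i.+1 by rewrite -actP //; apply: q.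
    have zp : (h^-1 * (alpha ^+ o) h) ^+ p \in Gs i.+1 by apply/pow/triv.
    apply: contraT => npm; case/negP: nh; have cop : coprime p m by rewrite prime_coprime.
    have m0 : 0 < m by rewrite lt0n; apply: contraNneq npm => ->; rewrite dvdn0.
    case: (egcdnP p m0) => a b ea _.
    rewrite gcdnC (eqP cop) in ea.
    have := groupX a zm; rewrite -expgM mulnC ea expgD expg1 mulnC expgM groupMl //.
    by rewrite groupX.
  rewrite mulnCA; split; first exact: layM.
  move=> u uG; rewrite actP // mulnC expgM groupX //.
  by apply: pow; apply: triv.
apply: returns_some_ret; split=> //=.
have trivS : quotient_fixed i.+1 o.
  apply: (trivial_on_generators pG autF (nG i.+1)) => j ltj.
  have [ltja | geja] := ltnP j (layer_end D i); first exact: trivg.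
  by apply: layI; rewrite -eA (gen_mem_tail _ pG).
move=> n; split=> [[lay /qS q] | /dvdnP[k ->]]; first exact/perO.
rewrite mulnC; split; first exact: layM.
by move=> h hG; rewrite actP // groupX // trivS.
Qed.

Lemma quotient_fixed_end i n : r <= i -> quotient_fixed i n <-> alpha ^+ n = 1.
Proof.
rewrite lenD => leri; have G1 : Gs i = 1%G by apply: nth_default.
split=> [q | e1 h hG]; last by rewrite e1 perm1 mulVg group1.
apply/permP => h; rewrite perm1; have [hG | nhG] := boolP (h \in G); last first.
  by rewrite (out_Aut _ nhG) ?groupX.
have := q h hG; rewrite G1 inE => /eqP e; by rewrite -[LHS](mulKVg h) e mulg1.
Qed.

Lemma fixed_end i n : r <= i ->
  (layers_fixed n /\ quotient_fixed i n) <-> alpha ^+ n = 1.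
Proof.
move=> leri; rewrite quotient_fixed_end //; split=> [[] // | e1]; split=> // j _ h hG.
by rewrite e1 perm1 mulVg group1.
Qed.

(** If there are no layers, G is trivial. *)
Lemma quotient_fixed_start n : layers_fixed n -> quotient_fixed 1 n.
Proof.
move=> lay h hG; have [r0 | r0] := posnP r; last by apply: (lay 0); rewrite ?(LG_group0 pG).
have : G = 1%G by rewrite -(LG_group0 pG) /LG_group nth_default // -lenD r0.
move=> G1; move: hG; rewrite G1 => /set1P->.
by rewrite (aut_one (G := G)) ?groupX // mulg1 invg1 group1.
Qed.

End AutOrderBody.

(** The loop starts with index 1 and so ends with index max(1, r), where the term
    of the series is trivial in either case. *)
Lemma AutOrderP (gT : finGroupType) (G : {group gT}) (X : seq gT) (R : seq pcrel)
          (alpha : {perm gT}) (A : seq (seq nat)) :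
     pcgs G X -> presentation_of X R ->
     alpha \in Aut G -> expmatrix X alpha A ->
     returns (AutOrder R A) #[alpha]%g.
Proof.
move=> pX pres autA mA.
have [a ra pa] : returns_some (AutOrder R A) (period (fun n => alpha ^+ n = 1)); last first.
  by rewrite (_ : #[alpha] = a) //; apply: period_unique pa => n; rewrite order_dvdn; split=> /eqP.
apply: returns_some_call => [||D]; first exact: period_unique.
  by apply: (LG_data_exists (ys := [::]) (pcgs_solvable pX) pX pres autA mA).
case=> gT' [G' [X' [g [ys [alpha' [[pX' pres'] [autA' mA' _] [pG refG _]
  [presD lenD weightD] [mD _]]]]]]].
apply: (@returns_some_weaken _ _ (period (fun n => alpha' ^+ n = 1))); last first.
  move=> a; apply: eq_period => n.
  by rewrite (aut_pow_eq1 pX pres n autA mA) (aut_pow_eq1 pX' pres' n autA' mA').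
apply: returns_some_bind (layers_orderP pG refG presD lenD weightD autA' mD) _ => o perO.
apply: returns_some_bind.
  apply: (@returns_some_foldM _ _ (fun i s =>
     period (fun n => layers_fixed G' D alpha' n /\ quotient_fixed G' alpha' i n) s.1 /\
     expmatrix g (alpha' ^+ s.1) s.2)).
    split=> /=; last exact: (pc_aut_powP pG presD o autA' mD).
    apply: eq_period perO => n; split=> [lay | [] //]; split=> //.
    exact: (quotient_fixed_start pG lenD autA' lay).
  move=> i s /andP[i0 lti] [perS mS]; apply: loop_stepP => //.
  by move: lti; case: (lg_length D) => [|r] //; rewrite ltnNge i0.
move=> s [perS _]; apply: returns_some_ret; apply: eq_period perS => n.
apply: fixed_end => //.
by case: (lg_length D).
Qed.

(** * The cycle length under an affine map *)

Section AffCycleBody.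
Variables (gT : finGroupType) (G : {group gT}) (g : seq gT) (D : LG_data).
Variables (alpha : {perm gT}) (x0 t0 : gT).
Hypotheses (pG : pcgs G g) (refG : refines_LG G g).
Hypotheses (presD : presentation_of g (lg_pres D)) (lenD : lg_length D = size (LG_series G)).
Hypothesis weightD : lg_weights D = [seq final_weight G x | x <- g].
Hypotheses (autA : alpha \in Aut G) (mA : expmatrix g alpha (lg_matrix D)).
Hypotheses (xG : x0 \in G) (tG : t0 \in G).
Variable xv : seq nat.
Hypothesis xvP : expvec g x0 xv.

Local Notation Gs := (LG_group G).
Local Notation r := (lg_length D).
Local Notation R := (lg_pres D).

Let F := affine_map t0 alpha.

Lemma affine_mem t (f : {perm gT}) n y : t \in G -> f \in Aut G -> y \in G ->
  iter n (affine_map t f) y \in G.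
Proof.
move=> tG' autF yG; elim: n => [|n IH] //=.
by rewrite /affine_map groupM // (aut_mem autF).
Qed.

(** Left translation by x0 conjugates the two affine maps and moves 1 to x0. *)
Lemma affine_translate t (f : {perm gT}) n : t \in G -> f \in Aut G ->
  x0^-1 * iter n (affine_map t f) x0 = iter n (affine_map (x0^-1 * (t * f x0)) f) 1.
Proof.
move=> tG' autF; elim: n => [|n IH]; first by rewrite mulVg.
have wG : x0^-1 * (t * f x0) \in G by rewrite groupM ?groupV // groupM // (aut_mem autF).
rewrite !iterS -IH; set y := iter n _ x0.
have yG : y \in G by apply: affine_mem.
rewrite /affine_map (aut_mulP autF) ?groupV // (aut_inv autF) //.
by rewrite -!mulgA mulKVg.
Qed.

(** The second condition says that the current pair represents F^lambda, where
    lambda is the current product. *)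
Definition affine_state i (s : nat * (seq nat * seq (seq nat))) : Prop :=
  period (fun n => x0^-1 * iter n F x0 \in Gs i.-1) s.1 /\
  exists2 t, affine_data G g (t, alpha ^+ s.1) s.2 &
    {in G, forall y, iter s.1 F y = affine_map t (alpha ^+ s.1) y}.

(** Only multiples n = lambda m can return x0 to its coset, and F^n is then the
    m-th power of the current affine map; after translation its orbit of 1 stays
    in the i-th term and is described by coordinates. *)
Lemma affine_stepP i s : 0 < i -> i <= r -> affine_state i s ->
  returns_some
    (let: (lam, (t1, A1)) := s in
       let w := pc_mul R (pc_inv R xv) (pc_mul R t1 (pc_app R A1 xv)) in
       bind (zero_cycle (layer_matrix D A1 i) (layer_vector D w i))
       (fun lam_i => Ret ((lam * lam_i)%N, pc_aff_pow R (t1, A1) lam_i)))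
    (affine_state i.+1).
Proof.
case: i => // i _; case: s => lam [tv A1] lti [/= perl [t dat itF]].
have [/= tG' autF tvP mF] := dat.
set f := alpha ^+ lam in dat itF autF mF.
have lti' : i < size (LG_series G) by rewrite -lenD.
have [[leg pr ord] [eA eB com pow]] := layer_factsP pG refG presD weightD lti'.
set w := x0^-1 * (t * f x0).
have wP : expvec g w (pc_mul R (pc_inv R xv) (pc_mul R tv (pc_app R A1 xv))).
  apply: (pc_mulP pG presD); first exact: pc_invP pG presD _ _ xvP.
  by apply: (pc_mulP pG presD) => //; apply: (pc_appP pG presD autF mF).
have wA : w \in tail_group g (layer_end D i).
  by rewrite eA; have := iffRL (perl lam) (dvdnn lam); rewrite itF.
have stA : {in tail_group g (layer_end D i), forall h, f h \in tail_group g (layer_end D i)}.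
  by rewrite eA => h; apply: (LG_group_stable pG autF).
have stB : {in tail_group g (layer_end D i + layer_size D i.+1), forall h,
      f h \in tail_group g (layer_end D i + layer_size D i.+1)}.
  by rewrite eB => h; apply: (LG_group_stable pG autF).
have [_ unitM] := layer_mx_unit pG leg pr ord com pow autF mF stA stB.
apply: returns_some_bind (zero_cycleP _ unitM) _ => lam1 perl1.
apply: returns_some_ret; split => /=.
  have sub n : x0^-1 * iter n F x0 \in Gs i.+1 -> x0^-1 * iter n F x0 \in Gs i.
    by move=> q; apply: subsetP (LG_group_sub pG (leqnSn i)) _ q.
  have iterE m y : y \in G -> iter (lam * m) F y = iter m (affine_map t f) y.
    move=> yG; elim: m => [|m IH]; first by rewrite muln0.
    by rewrite mulnS iterD IH itF // affine_mem.
  have key m : x0^-1 * iter (lam * m) F x0 \in Gs i.+1 <-> lam1 %| m.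
    rewrite iterE // affine_translate // -/w.
    rewrite -(perl1 m).
    have [wA' cE] := layer_affine pG leg pr ord com pow m autF mF stA stB wA.
    rewrite -eB -(coords_eq0 pG leg pr ord wA') cE.
    by rewrite (coordsE _ _ _ pG wP).
  move=> n; split=> [q | /dvdnP[k ->]].
    have /dvdnP[m en] : lam %| n by apply/perl/sub.
    move: q; rewrite en mulnC => /key d; exact: dvdn_mul.
  by rewrite mulnCA; apply/key/dvdn_mull.
have [t' dat' it'] := pc_aff_powP pG presD lam1 dat.
exists t'; rewrite expgM //.
move=> y yG; rewrite mulnC iterM -it' //; elim: lam1 {perl1 dat' it'} => //= m IH.
by rewrite IH itF // affine_mem.
Qed.
End AffCycleBody.

(** The affine map is a permutation of a finite set, so the period is
    positive. *)
Lemma AffCycleP (gT : finGroupType) (G : {group gT}) (X : seq gT) (R : seq pcrel)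
          (x t : gT) (alpha : {perm gT}) (xv tv : seq nat) (A : seq (seq nat)) :
     pcgs G X -> presentation_of X R ->
     x \in G -> t \in G -> expvec X x xv -> expvec X t tv ->
     alpha \in Aut G -> expmatrix X alpha A ->
     exists2 n, is_cycle_length (affine_map t alpha) x n
              & returns (AffCycle R xv tv A) n.
Proof.
move=> pX pres xG tG xvP tvP autA mA.
have [a ra pa] : returns_some (AffCycle R xv tv A)
    (period (fun n => iter n (affine_map t alpha) x = x)).
  apply: returns_some_call => [||D]; first exact: period_unique.
    apply: (LG_data_exists (ys := [:: x; t]) (pcgs_solvable pX) pX pres autA mA).
      by move=> y; rewrite !inE => /pred2P[]->.
    by split=> // -[|[|]].
  case=> gT' [G' [X' [g [ys [alpha' [[pX' pres'] [autA' mA' [szy ysP]] [pG refG _]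
    [presD lenD weightD] [mD [szes esP]]]]]]]].
  case: ys szy szes ysP esP => [|x' [|t' [|]]] // _ szes ysP esP.
  have [xvP' tvP'] : expvec X' x' xv /\ expvec X' t' tv.
    by split; [apply: (ysP 0) | apply: (ysP 1%N)].
  have [xdP tdP] : expvec g x' (nth [::] (lg_elts D) 0) /\ expvec g t' (nth [::] (lg_elts D) 1).
    by split; [apply: (esP 0) | apply: (esP 1%N)].
  have x'G := pcgs_mem pX' xvP'; have t'G := pcgs_mem pX' tvP'.
  apply: (@returns_some_weaken _ _
    (period (fun n => iter n (affine_map t' alpha') x' = x'))); last first.
    move=> a; apply: eq_period => n.
    by rewrite (affine_cycle_eq pX pres n autA mA tvP xvP)
               (affine_cycle_eq pX' pres' n autA' mA' tvP' xvP').
  apply: returns_some_bind.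
    apply: (@returns_some_foldM _ _ (affine_state G' g alpha' x' t')).
      split=> /=.
        by move=> n; rewrite dvd1n (LG_group0 pG) groupM ?groupV // affine_mem.
      by exists t'; rewrite ?expg1.
    move=> i s /andP[i0 lti]; apply: affine_stepP => //.
  move=> s [perS _]; apply: returns_some_ret; apply: eq_period perS => n.
  rewrite /= /LG_group nth_default ?lenD // inE -eq_mulVg1 eq_sym.
  by split=> [/eqP | ->].
have injF : injective (affine_map t alpha).
  by move=> y z /mulgI/perm_inj.
exists a => //; apply: period_least_pos (pa).
by apply: dvdn_gt0 (fingraph.order_gt0 (affine_map t alpha) x) _; apply/pa/iter_order.
Qed.

End GroupTheory.

Theorem theorem1p2p1 :
  (forall (gT : finGroupType) (G : {group gT}) (X : seq gT) (R : seq pcrel)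
          (alpha : {perm gT}) (A : seq (seq nat)),
     solvable G -> pcgs G X -> presentation_of X R ->
     alpha \in Aut G -> expmatrix X alpha A ->
     returns (AutOrder R A) #[alpha]%g)
  /\
  (forall (gT : finGroupType) (G : {group gT}) (X : seq gT) (R : seq pcrel)
          (g t : gT) (alpha : {perm gT}) (gv tv : seq nat) (A : seq (seq nat)),
     solvable G -> pcgs G X -> presentation_of X R ->
     g \in G -> t \in G -> expvec X g gv -> expvec X t tv ->
     alpha \in Aut G -> expmatrix X alpha A ->
     exists2 n, is_cycle_length (affine_map t alpha) g n
              & returns (AffCycle R gv tv A) n).
Proof.
split=> [gT G X R alpha A _ | gT G X R g t alpha gv tv A _]; first exact: AutOrderP.
exact: AffCycleP.
Qed.
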